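(* Let $\kappa$ be a regular uncountable cardinal and assume the proxy principle $\mathrm{P}(\kappa,2,{\sqsubseteq},\kappa)$. If there exists a $\kappa$-Kurepa tree, then there exists a $\kappa$-Aronszajn tree $\mathbf T$ admitting $\kappa^+$-many subtrees, each of which is a $\kappa$-Souslin tree, such that the product of any finitely many (at least one) distinct ones among them is again a $\kappa$-Souslin tree.
   Context: A $\kappa$-tree is a tree of height $\kappa$ all of whose levels are nonempty and of size $<\kappa$; a $\kappa$-Aronszajn tree is a $\kappa$-tree with no branch of length $\kappa$; a $\kappa$-Souslin tree is a $\kappa$-Aronszajn tree with no antichain of size $\kappa$; a $\kappa$-Kurepa tree is a $\kappa$-tree with more than $\kappa$ cofinal branches. A subtree of a tree means a downward-closed subset. The product $\bigotimes_{j<\tau}T^j$ of trees $T^j$ is the set of sequences $\langle x_j\mid j<\tau\rangle$ with $x_j\in T^j$, all $x_j$ of the same height, ordered coordinatewise (strictly below in every coordinate). Notation: for a set $C$ of ordinals, $\mathrm{acc}(C)=\{\beta\in C\mid \sup(C\cap\beta)=\beta>0\}$ and $\mathrm{nacc}(C)=C\setminus\mathrm{acc}(C)$; for $n<\omega$ and a set $D$ of ordinals, $\mathrm{suc}_n(D)=\{\delta\in\mathrm{nacc}(D)\mid 0<\mathrm{otp}(D\cap\delta)\le n\}$. $\mathrm{P}(\kappa,2,{\sqsubseteq},\kappa)$ is the conjunction of $\diamondsuit(\kappa)$ with the assertion that there is a sequence $\langle C_\alpha\mid\alpha<\kappa\rangle$ such that: (1) each $C_\alpha$ is a closed subset of $\alpha$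 with $\sup(C_\alpha)=\sup(\alpha)$ (where $\sup(\alpha)=\bigcup\alpha$); (2) for all $\alpha<\kappa$ and $\bar\alpha\in\mathrm{acc}(C_\alpha)$, $C_{\bar\alpha}=C_\alpha\cap\bar\alpha$; (3) for every sequence $\langle B_i\mid i<\kappa\rangle$ of cofinal subsets of $\kappa$ there are stationarily many $\alpha<\kappa$ such that for all $i<\alpha$ and all $n<\omega$, $\sup\{\beta\in C_\alpha\mid \mathrm{suc}_n(C_\alpha\setminus\beta)\subseteq B_i\}=\alpha$. *)

(* Defs.v *)
(* Ordinals below kappa are modelled as the elements of a type
   K carrying a strict well-order lt; kappa itself is (the order type of) K. *)
From Stdlib Require Import List.
Set Implicit Arguments.

Definition injects (A B : Type) : Prop :=
  exists f : A -> B, forall x y, f x = f y -> x = y.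

Definition strict_wellorder {A : Type} (r : A -> A -> Prop) : Prop :=
  (forall x, ~ r x x) /\ (forall x y z, r x y -> r y z -> r x z) /\
  (forall x y, r x y \/ x = y \/ r y x) /\ well_founded r.

Section Ordinals.
Variables (K : Type) (lt : K -> K -> Prop).

Definition le (a b : K) : Prop := lt a b \/ a = b.

Definition regular_uncountable_cardinal : Prop :=
  strict_wellorder lt /\
  ~ injects K nat /\
  (forall a : K, ~ injects K {b : K | lt b a}) /\
  (forall X : K -> Prop, (forall a, exists b, X b /\ lt a b) ->
     injects K {b : K | X b}).

(* s = sup X (least upper bound; sup of the empty set is the least element) *)
Definition is_sup (X : K -> Prop) (s : K) : Prop :=
  (forall x, X x -> le x s) /\ (forall t, (forall x, X x -> le x t) -> le s t).

Definition unbounded (X : K -> Prop) : Prop := forall a, exists b, X b /\ lt a b.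

Definition acc (C : K -> Prop) (b : K) : Prop :=
  C b /\ is_sup (fun x => C x /\ lt x b) b /\ exists z, lt z b.
Definition nacc (C : K -> Prop) (b : K) : Prop := C b /\ ~ acc C b.

(* suc_n(D) = { d in nacc(D) | 0 < otp(D cap d) <= n } *)
Definition suc (n : nat) (D : K -> Prop) (d : K) : Prop :=
  nacc D d /\ exists l : list K, NoDup l /\ 1 <= length l <= n /\
     forall x, In x l <-> (D x /\ lt x d).

Definition club (C : K -> Prop) : Prop :=
  unbounded C /\
  forall b, is_sup (fun x => C x /\ lt x b) b -> (exists z, lt z b) -> C b.
Definition stationary (S : K -> Prop) : Prop :=
  forall C, club C -> exists a, C a /\ S a.

Definition diamond : Prop :=
  exists A : K -> K -> Prop, (forall a b, A a b -> lt b a) /\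
    forall X : K -> Prop,
      stationary (fun a => forall b, lt b a -> (X b <-> A a b)).

Definition proxy_principle : Prop :=
  diamond /\
  exists C : K -> K -> Prop,
    (forall a, (forall b, C a b -> lt b a) /\
       (forall b, lt b a -> is_sup (fun x => C a x /\ lt x b) b ->
                  (exists z, lt z b) -> C a b) /\
       exists s, is_sup (fun b => lt b a) s /\ is_sup (C a) s) /\
    (forall a b, acc (C a) b -> forall x, C b x <-> (C a x /\ lt x b)) /\
    (forall B : K -> K -> Prop, (forall i, unbounded (B i)) ->
       stationary (fun a => forall i, lt i a -> forall n : nat,
         is_sup (fun b => C a b /\
                   forall d, suc n (fun x => C a x /\ le b x) d -> B i d) a)).

End Ordinals.

Section Trees.
Variables (K : Type) (lt : K -> K -> Prop).
Variables (X : Type) (R : X -> X -> Prop).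

Definition is_tree : Prop :=
  (forall x, ~ R x x) /\ (forall x y z, R x y -> R y z -> R x z) /\
  (forall x y z, R y x -> R z x -> R y z \/ y = z \/ R z y) /\
  (forall x, well_founded
     (fun u v : {y : X | R y x} => R (proj1_sig u) (proj1_sig v))).

Definition height (x : X) (a : K) : Prop :=
  exists f : {y : X | R y x} -> {b : K | lt b a},
    (forall u v, R (proj1_sig u) (proj1_sig v) <-> lt (proj1_sig (f u)) (proj1_sig (f v))) /\
    (forall w, exists u, f u = w).

Definition kappa_tree : Prop :=
  is_tree /\
  (forall x, exists a, height x a) /\
  (forall a, exists x, height x a) /\
  (forall a, ~ injects K {x : X | height x a}).

Definition cofinal_branch (B : X -> Prop) : Prop :=
  (forall x y, B x -> B y -> R x y \/ x = y \/ R y x) /\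
  (forall x y, B y -> R x y -> B x) /\
  (forall a, exists x, B x /\ height x a).

Definition aronszajn : Prop :=
  kappa_tree /\ ~ exists B, cofinal_branch B.

Definition souslin : Prop :=
  aronszajn /\
  ~ exists f : K -> X, (forall a b, f a = f b -> a = b) /\
       (forall a b, a <> b -> ~ R (f a) (f b)).

Definition kurepa : Prop :=
  kappa_tree /\
  ~ exists f : {B : X -> Prop | cofinal_branch B} -> K,
      forall u v, f u = f v -> forall x, proj1_sig u x <-> proj1_sig v x.

Definition subtree (S : X -> Prop) : Prop := forall x y, S y -> R x y -> S x.

Definition sub_rel (S : X -> Prop) (u v : {x : X | S x}) : Prop :=
  R (proj1_sig u) (proj1_sig v).

Definition prod_type {I : Type} (S : I -> X -> Prop) (F : I -> Prop) : Type :=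
  {f : {i : I | F i} -> X |
     (forall i, S (proj1_sig i) (f i)) /\ exists a, forall i, height (f i) a}.

Definition prod_rel {I : Type} (S : I -> X -> Prop) (F : I -> Prop)
  (f g : prod_type S F) : Prop :=
  forall i, R (proj1_sig f i) (proj1_sig g i).

End Trees.

(* Main.v *)
(** The cofinal branches of the Kurepa tree index the Souslin trees: the level [a] of the tree
    of a branch [j] is built by a microscopic construction that only depends on [j] below [a],
    so that the trees of two branches share a common initial part, and the union [T] of all of
    them has small levels.  A cofinal branch of [T] determines a cofinal branch [j] of the
    Kurepa tree and would be a cofinal branch of the Souslin tree of [j].

    A node of level [a] is the limit of a path along the club [C_a], starting in any lower
    node; coherence of the clubs lets the path pass through [acc C_a].  At successive elements
    [b < b'] of [C_a], the diamond guess at [b'] may prescribe a finite set of branches, a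
    starting node for each of them, and a dense open subset of the product of their trees; then
    the paths with these starting nodes move simultaneously from [b] to [b'] through the dense
    set.  The proxy principle (with [n = 1]) yields a level [a] at which every finite tuple of
    paths is treated with correct guesses, so a whole level of the product lies in a given
    dense open set.  Applied to the complement of a branch, and to the nodes that are above or
    incompatible with all elements of an antichain, this shows that the products are Souslin. *)
Require Import Defs.
From Stdlib Require Import List PeanoNat Wf_nat Wellfounded.
From Stdlib Require Import Classical ClassicalEpsilon FunctionalExtensionality PropExtensionality.
From mathcomp Require boolp wochoice.
Set Implicit Arguments.
Set Bullet Behavior "Strict Subproofs".

(** * Smallness, choice and well-orders *)

(** Since [K] stands for a cardinal, the absence of an injection from [K] means size less than
    kappa; the definitions of trees bound levels in this form. *)
Definition small (K A : Type) : Prop := ~ injects K A.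

Lemma injects_trans (A B C : Type) : injects A B -> injects B C -> injects A C.
Proof.
  intros [f Hf] [g Hg]. exists (fun x => g (f x)). auto.
Qed.

(** Choice turns a total relation into a map. Most cardinality bounds below give only such a
    relation and never name the chosen values. *)
Lemma injects_rel (A B : Type) (Q : A -> B -> Prop) :
  (forall a, exists b, Q a b) ->
  (forall a a' b, Q a b -> Q a' b -> a = a') -> injects A B.
Proof.
  intros H1 H2.
  exists (fun a => proj1_sig (constructive_indefinite_description _ (H1 a))).
  intros x y. destruct constructive_indefinite_description as [u Hu].
  destruct constructive_indefinite_description as [v Hv]; simpl.
  intros ->. eauto.
Qed.

Lemma sig_eq (A : Type) (P : A -> Prop) (u v : {x : A | P x}) :
  proj1_sig u = proj1_sig v -> u = v.
Proof.
  destruct u as [u Hu], v as [v Hv]; simpl; intros <-. f_equal. apply proof_irrelevance.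
Qed.

Lemma wf_least (A : Type) (r : A -> A -> Prop) (P : A -> Prop) :
  well_founded r -> (exists x, P x) -> exists x, P x /\ forall y, r y x -> ~ P y.
Proof.
  intros W [x Hx]. revert Hx. induction x as [x IH] using (well_founded_induction W).
  intros Hx. destruct (classic (exists y, r y x /\ P y)) as [[y [Hy1 Hy2]]|N].
  - eauto.
  - exists x. split; auto. intros y Hy HP. eauto.
Qed.

(** The well-ordering principle provides unique minima of nonempty boolean predicates; [M] restates
    this for propositions. The order axioms are read off from minima of sets with at most three
    elements. *)
Lemma well_ordering (A : Type) : exists r : A -> A -> Prop, strict_wellorder r.
Proof.
  destruct (wochoice.well_ordering_principle (boolp.boolp_classicType__canonical__eqtype_Equality A)) as [r Hr].
  assert (M : forall P : A -> Prop, (exists x, P x) ->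
    exists z, P z /\ (forall x, P x -> r z x = true) /\
      forall z', P z' -> (forall x, P x -> r z' x = true) -> z' = z).
  { intros P [x Hx].
    set (Q := fun x : A => if excluded_middle_informative (P x) then true else false).
    assert (HQ : forall x, Q x = true <-> P x).
    { intros y. unfold Q. destruct excluded_middle_informative; split; intros; congruence || auto. }
    destruct (Hr Q) as [z [[Hz1 Hz2] Hz3]].
    - exists x. apply HQ, Hx.
    - exists z. split; [apply HQ, Hz1|]. split.
      + intros y Hy. apply Hz2. apply HQ, Hy.
      + intros z' H1 H2. symmetry. apply Hz3. split.
        * apply HQ, H1.
        * intros y Hy. apply H2, HQ, Hy. }
  assert (Refl : forall x, r x x = true).
  { intros x. destruct (M (fun y => y = x)) as [z [-> [Hz _]]]; eauto. }
  assert (Anti : forall x y, r x y = true -> r y x = true -> x = y).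
  { intros x y Hxy Hyx. destruct (M (fun z => z = x \/ z = y)) as [z [_ [_ Hz]]]; [eauto|].
    transitivity z; [|symmetry]; apply Hz; auto; intros w [->| ->]; auto. }
  assert (Tot : forall x y, r x y = true \/ r y x = true).
  { intros x y. destruct (M (fun z => z = x \/ z = y)) as [z [[->| ->] [Hz _]]]; eauto. }
  assert (Trans : forall x y z, r x y = true -> r y z = true -> r x z = true).
  { intros x y z Hxy Hyz.
    destruct (M (fun w => w = x \/ w = y \/ w = z)) as [w [[->|[->| ->]] [Hw _]]]; eauto.
    - assert (x = y) by auto. subst. auto.
    - assert (y = z) by auto. subst. auto. }
  exists (fun x y => r x y = true /\ x <> y). split; [|split; [|split]].
  - intros x [_ N]; auto.
  - intros x y z [H1 N1] [H2 N2]. split; eauto. intros ->. auto.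
  - intros x y. destruct (classic (x = y)); auto. destruct (Tot x y); auto.
  - intros x. apply NNPP. intros N.
    destruct (M (fun y => ~ Acc (fun x y => r x y = true /\ x <> y) y)) as [z [Hz1 [Hz2 _]]]; [eauto|].
    apply Hz1. constructor. intros y [Hy1 Hy2]. apply NNPP. intros N'.
    apply Hy2. auto.
Qed.

Definition lt_dec (K : Type) (lt : K -> K -> Prop) (a b : K) : {lt a b} + {~ lt a b} :=
  excluded_middle_informative (lt a b).

(** * Sets of size less than kappa *)

Section Cardinal.
Variables (K : Type) (lt : K -> K -> Prop).
Hypothesis HK : regular_uncountable_cardinal lt.

Notation "a < b" := (lt a b).
Notation "a <= b" := (le lt a b).

Lemma lt_irr a : ~ a < a.
Proof. apply HK. Qed.

Lemma lt_tr a b c : a < b -> b < c -> a < c.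
Proof. apply HK. Qed.

Lemma lt_tot a b : a < b \/ a = b \/ b < a.
Proof. apply HK. Qed.

Lemma lt_wf : well_founded lt.
Proof. apply HK. Qed.

Lemma le_lt_tr a b c : a <= b -> b < c -> a < c.
Proof. intros [H| ->]; eauto using lt_tr. Qed.

Lemma lt_le_tr a b c : a < b -> b <= c -> a < c.
Proof. intros H [H'| <-]; eauto using lt_tr. Qed.

Lemma le_tr a b c : a <= b -> b <= c -> a <= c.
Proof. intros [H| ->]; auto. intros H'. left. eauto using lt_le_tr. Qed.

Lemma le_refl a : a <= a.
Proof. right; auto. Qed.

Lemma nlt_le a b : ~ a < b <-> b <= a.
Proof.
  split.
  - intros N. destruct (lt_tot a b) as [|[| ]]; [tauto|right|left]; auto.
  - intros H H'. apply (lt_irr (le_lt_tr H H')).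
Qed.

Lemma nle_lt a b : ~ a <= b <-> b < a.
Proof. rewrite <- nlt_le. split; [apply NNPP|tauto]. Qed.

Lemma le_antisym a b : a <= b -> b <= a -> a = b.
Proof. intros [H|]; auto. intros H'. destruct (lt_irr (lt_le_tr H H')). Qed.

Lemma lt_le a b : a < b -> a <= b.
Proof. left; auto. Qed.

Lemma small_nat : small K nat.
Proof. apply HK. Qed.

Lemma small_seg a : small K {b | b < a}.
Proof. apply HK. Qed.

Lemma small_inj A B : injects A B -> small K B -> small K A.
Proof. intros H N H'. apply N. eauto using injects_trans. Qed.

Lemma inhabited_K : inhabited K.
Proof.
  apply NNPP. intros N. apply small_nat. exists (fun x => 0%nat).
  intros x. destruct N; constructor; exact x.
Qed.

(* Hilbert's hotel: with a greatest element [m], shifting the sequence of finite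
   successors would inject [K] into the segment below [m]. *)
Lemma no_max a : exists b, a < b.
Proof.
  apply NNPP. intros Nm.
  assert (Hm : forall x, x <= a). { intros x. apply nlt_le. eauto. }
  assert (HS : forall x, exists y, x < a -> x < y /\ forall z, x < z -> y <= z).
  { intros x. destruct (classic (x < a)) as [H|H]; [|exists a; tauto].
    destruct (wf_least (fun y => x < y) lt_wf) as [y [Hy1 Hy2]]; [eauto|].
    exists y. intros _. split; auto. intros z Hz. apply nlt_le. intros H'. apply (Hy2 z); auto. }
  set (S x := proj1_sig (constructive_indefinite_description _ (HS x))).
  assert (S_lt : forall x, x < a -> x < S x).
  { intros x Hx. unfold S. destruct constructive_indefinite_description; simpl. apply a0; auto. }
  assert (S_le : forall x z, x < a -> x < z -> S x <= z).
  { intros x z Hx. unfold S. destruct constructive_indefinite_description; simpl. apply a0; auto. }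
  clearbody S.
  destruct (wf_least (fun y => True) lt_wf) as [o [_ Ho]]; [eauto|].
  assert (Ho' : forall x, o <= x). { intros x. apply nlt_le. intros H. apply (Ho x); auto. }
  set (e n := Nat.iter n S o).
  assert (He : forall n x, (forall k, (k < n)%nat -> e k < a) -> x < e n ->
             exists k, (k < n)%nat /\ x = e k).
  { induction n as [|n IH]; intros x Hk Hx.
    - destruct (lt_irr (lt_le_tr Hx (Ho' x))).
    - destruct (classic (x < e n)) as [H|H].
      + destruct (IH x) as [k [H1 H2]]; auto. exists k; split; auto.
      + exists n. split; auto. rewrite nlt_le in H. destruct H as [H|H]; auto.
        assert (H' : S (e n) <= x) by (apply S_le; auto).
        destruct (lt_irr (lt_le_tr Hx H')). }
  destruct (classic (forall n, e n < a)) as [Hall|Hex].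
  - assert (Hmono : forall n k, (n < k)%nat -> e n < e k).
    { intros n k. induction 1.
      - simpl. apply S_lt; auto.
      - eapply lt_tr; [eassumption|]. simpl. apply S_lt; auto. }
    assert (Hinj : forall n k, e n = e k -> n = k).
    { intros n k E. destruct (Nat.lt_trichotomy n k) as [H|[H|H]]; auto;
        apply Hmono in H; rewrite E in H; destruct (lt_irr H). }
    clearbody e. apply (small_seg (a:=a)).
    apply (injects_rel (fun x (y : {b | b < a}) =>
      (x = a /\ proj1_sig y = e 0%nat) \/ (exists n, x = e n /\ proj1_sig y = e (Datatypes.S n))
      \/ (x <> a /\ (forall n, x <> e n) /\ proj1_sig y = x))).
    + intros x. destruct (classic (x = a)) as [->|Hxa].
      { exists (exist (fun b => b < a) _ (Hall 0%nat)). auto. }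
      destruct (classic (exists n, x = e n)) as [[n ->]|Hn].
      { exists (exist (fun b => b < a) _ (Hall (Datatypes.S n))). right; left. exists n. auto. }
      destruct (Hm x) as [Hx|Hx]; [|contradiction].
      exists (exist (fun b => b < a) x Hx). right; right. repeat split; auto. intros n ->. eauto.
    + intros x x' [y Hy]; simpl.
      intros [[E1 E2]|[(n & E1 & E2)|(E1 & E2 & E3)]] [[F1 F2]|[(n' & F1 & F2)|(F1 & F2 & F3)]];
        subst; auto; try (rewrite E2 in F2; apply Hinj in F2; try congruence; discriminate);
        try congruence; firstorder congruence.
  - destruct (not_all_ex_not _ _ Hex) as [n0 Hn0].
    destruct (wf_least (fun n => ~ e n < a) Wf_nat.lt_wf) as [n [Hn1 Hn2]]; [eauto|].
    assert (En : e n = a). { apply le_antisym; auto. apply nlt_le; auto. }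
    apply small_nat. apply (injects_rel (fun x k => x = e k)).
    + intros x. destruct (Hm x) as [Hx|Hx]; [|exists n; congruence].
      rewrite <- En in Hx. apply He in Hx.
      * destruct Hx as (k & _ & Hk). eauto.
      * intros k Hk. apply NNPP. apply (Hn2 k Hk).
    + congruence.
Qed.

(** This is regularity: an unbounded range would have size kappa, and choosing preimages would
    inject it into [A]. *)
Lemma small_range_bounded (A : Type) (f : A -> K) :
  small K A -> exists u, forall x, f x < u.
Proof.
  intros HA. apply NNPP. intros N. apply HA.
  destruct HK as (_ & _ & _ & Hreg).
  apply (@injects_trans _ {b | exists x, b = f x}).
  - apply Hreg. intros a. apply NNPP. intros N'. apply N.
    destruct (no_max a) as [u Hu]. exists u. intros x.
    apply NNPP. intros Hx. apply N'. exists (f x). split; eauto.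
    rewrite nlt_le in Hx. eauto using lt_le_tr.
  - apply (injects_rel (fun (b : {b | exists c, b = f c}) c => proj1_sig b = f c)).
    * intros [b [c Hc]]. exists c; auto.
    * intros b b' c H1 H2. apply sig_eq. congruence.
Qed.

(** An injection [f] of [K] into [W] would split [K] into the sets where [p (f x)] is constant. Each
    is small, hence bounded, and the bounds have a common bound [v]; the class of [v] itself
    contradicts this. *)
Lemma small_fibres (A W : Type) (p : W -> A) :
  small K A -> (forall a, small K {w | p w = a}) -> small K W.
Proof.
  intros HA HB [f Hf].
  assert (Hb : forall a, exists u, forall x, p (f x) = a -> x < u).
  { intros a. apply NNPP. intros N. apply (HB a).
    assert (Hr : forall u, exists x, p (f x) = a /\ u < x).
    { intros u. destruct (no_max u) as [v Hv].
      apply NNPP. intros N'. apply N. exists v. intros x Hx.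
      apply NNPP. intros H. apply N'. exists x. split; auto.
      rewrite nlt_le in H. eauto using lt_le_tr. }
    destruct HK as (_ & _ & _ & Hreg).
    apply (@injects_trans _ {x | p (f x) = a}); [apply Hreg, Hr|].
    exists (fun x : {x | p (f x) = a} => exist (fun w => p w = a) (f (proj1_sig x)) (proj2_sig x)).
    intros u v E. apply sig_eq, Hf. exact (f_equal (@proj1_sig _ _) E). }
  set (u := fun a => proj1_sig (constructive_indefinite_description _ (Hb a))).
  destruct (@small_range_bounded A u HA) as [v Hv].
  apply (lt_irr (a:=v)). apply (@lt_tr _ (u (p (f v)))); auto.
  unfold u. destruct constructive_indefinite_description as [w Hw]; simpl. auto.
Qed.

(** There are countably many lengths, and lists of a fixed length are counted by induction, fibring
    over the head. *)
Lemma small_list (A : Type) (P : A -> Prop) :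
  small K {x | P x} -> small K {l | Forall P l}.
Proof.
  intros HP.
  apply (small_fibres (fun l : {l | Forall P l} => length (proj1_sig l)) small_nat).
  intros n. induction n as [|n IH].
  - intros [f Hf]. apply small_nat. exists (fun x => 0%nat). intros x y _. apply Hf.
    apply sig_eq, sig_eq. destruct (f x) as [[l Hl] E], (f y) as [[l' Hl'] E']; simpl in *.
    destruct l, l'; try discriminate; auto.
  - set (W := {l : {l | Forall P l} | length (proj1_sig l) = S n}).
    assert (Hh : forall w : W, exists x : {x | P x}, exists l, proj1_sig (proj1_sig w) = proj1_sig x :: l).
    { intros [[[|x l] Hl] E]; simpl in *; [discriminate|].
      exists (exist P x (Forall_inv Hl)). eauto. }
    set (h := fun w => proj1_sig (constructive_indefinite_description _ (Hh w))).
    assert (Hh' : forall w, exists l, proj1_sig (proj1_sig w) = proj1_sig (h w) :: l).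
    { intros w. unfold h. destruct constructive_indefinite_description; auto. }
    clearbody h. apply (small_fibres h HP). intros a.
    refine (@small_inj _ _ _ IH).
    apply (injects_rel (fun (w : {w | h w = a}) (l : {l : {l | Forall P l} | length (proj1_sig l) = n}) =>
       proj1_sig (proj1_sig (proj1_sig w)) = proj1_sig a :: proj1_sig (proj1_sig l))).
    + intros [w Ew]. destruct (Hh' w) as [l Hl]. rewrite Ew in Hl.
      destruct w as [[l0 Hl0] El]. simpl in *. subst l0.
      unshelve eexists (exist _ (exist _ l _) _); simpl; auto.
      exact (Forall_inv_tail Hl0).
    + intros w w' l E E'. apply sig_eq, sig_eq, sig_eq. congruence.
Qed.

Lemma small_prod (A B : Type) : small K A -> small K B -> small K (A * B).
Proof.
  intros HA HB. apply (small_fibres (@fst A B) HA). intros a. refine (small_inj _ HB).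
  exists (fun w : {w : A * B | fst w = a} => snd (proj1_sig w)).
  intros [[x y] E] [[x' y'] E'] E''. apply sig_eq. simpl in *. congruence.
Qed.

Lemma small_In (A : Type) (l : list A) : small K {x | In x l}.
Proof.
  refine (small_inj _ small_nat).
  apply (injects_rel (fun (x : {x | In x l}) n => nth_error l n = Some (proj1_sig x))).
  - intros [x Hx]. apply In_nth_error, Hx.
  - intros x y n E E'. apply sig_eq. congruence.
Qed.

Lemma upper_bound2 a b : exists c, a <= c /\ b <= c.
Proof.
  destruct (lt_tot a b) as [H|[H|H]]; [exists b|exists b|exists a]; split;
    auto using le_refl, lt_le; subst; apply le_refl.
Qed.

(** Ordering [W] first by rank and then by an arbitrary well-order makes all initial segments small,
    so recursion can always choose a value in [K] not taken before. *)
Lemma small_rank_injects (W : Type) (rank : W -> K) :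
  (forall a, small K {w | rank w = a}) -> injects W K.
Proof.
  intros Hr. destruct (well_ordering W) as [r Wr].
  set (R w w' := rank w < rank w' \/ (rank w = rank w' /\ r w w')).
  assert (RW : well_founded R).
  { assert (H : forall a w, rank w = a -> Acc R w).
    { intros a. induction a as [a IH] using (well_founded_induction lt_wf).
      intros w. induction w as [w IHw] using (well_founded_induction (proj2 (proj2 (proj2 Wr)))).
      intros E. constructor. intros w' [H|[H1 H2]].
      - apply (IH (rank w')); congruence.
      - apply IHw; congruence. }
    intros w. eauto. }
  assert (Rtot : forall w w', R w w' \/ w = w' \/ R w' w).
  { intros w w'. unfold R. destruct (lt_tot (rank w) (rank w')) as [|[E|]]; auto.
    destruct Wr as (_ & _ & Tot & _). destruct (Tot w w') as [|[|]]; auto. }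
  assert (Rsmall : forall w, small K {w' | R w' w}).
  { intros w.
    destruct (no_max (rank w)) as [u Hu].
    apply (small_fibres (fun w' : {w' | R w' w} =>
      exist (fun b => b < u) (rank (proj1_sig w')) (match proj2_sig w' with
        | or_introl H => lt_tr H Hu | or_intror H => eq_ind_r (fun b => b < u) Hu (proj1 H) end))).
    - apply small_seg.
    - intros [a Ha]. refine (small_inj _ (Hr a)).
      apply (injects_rel (fun (x : {w0 : {w' | R w' w} | _}) (y : {w | rank w = a}) =>
        proj1_sig (proj1_sig x) = proj1_sig y)).
      + intros [x Ex]. exists (exist _ (proj1_sig x) (f_equal (@proj1_sig _ _) Ex)). reflexivity.
      + intros x x' y E E'. apply sig_eq, sig_eq. congruence. }
  assert (Hf : forall w (f : {w' | R w' w} -> K), exists a, forall w', f w' <> a).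
  { intros w f. apply NNPP. intros N. apply (Rsmall w).
    apply (injects_rel (fun a w' => f w' = a)); [|congruence].
    intros a. apply NNPP. intros N'. apply N. exists a. intros w' E. eauto. }
  set (F := Fix RW (fun _ => K) (fun w rec =>
     proj1_sig (constructive_indefinite_description _
       (Hf w (fun w' => rec (proj1_sig w') (proj2_sig w')))))).
  assert (HF : forall w w', R w' w -> F w' <> F w).
  { intros w w' Hw. unfold F at 2. rewrite Fix_eq.
    - destruct constructive_indefinite_description as [a Ha]; simpl.
      exact (Ha (exist _ w' Hw)).
    - intros x f g E. f_equal. f_equal. replace f with g; auto.
      extensionality y. extensionality p. auto. }
  exists F. intros w w' E. destruct (Rtot w w') as [H|[H|H]]; auto;
    destruct (HF _ _ H); auto.
Qed.

(** For unboundedness, [h x] exceeds [x] and all [g c] with [c <= x]. The least ordinal above the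
    iterates of [h] is closed under [g]; it exists because countable sets are bounded. *)
Lemma club_closed (g : K -> K) a :
  club lt (fun b => a < b /\ forall c, c < b -> g c < b).
Proof.
  assert (Hh : forall x, exists y, x < y /\ forall c, c <= x -> g c < y).
  { intros x. destruct (no_max x) as [x' Hx'].
    destruct (@small_range_bounded {c | c < x'} (fun c => g (proj1_sig c)) (small_seg (a:=x')))
      as [u Hu].
    destruct (lt_tot x u) as [H|H].
    - exists u. split; auto. intros c Hc.
      exact (Hu (exist (fun c => c < x') c (le_lt_tr Hc Hx'))).
    - exists x'. split; auto. intros c Hc. apply (@lt_tr _ u).
      + exact (Hu (exist (fun c => c < x') c (le_lt_tr Hc Hx'))).
      + destruct H as [<-|H]; eauto using lt_tr. }
  set (h := fun x => proj1_sig (constructive_indefinite_description _ (Hh x))).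
  assert (Hh' : forall x, x < h x /\ forall c, c <= x -> g c < h x).
  { intros x. unfold h. destruct constructive_indefinite_description; auto. }
  clearbody h. split.
  - intros d.
    assert (exists x0, a <= x0 /\ d <= x0) as (x0 & Ha & Hd).
    { destruct (classic (a < d)); [exists d|exists a]; split;
        try apply le_refl; try (left; assumption). apply nlt_le; auto. }
    set (x n := Nat.iter n h x0).
    destruct (@small_range_bounded nat x small_nat) as [u Hu].
    destruct (wf_least (fun u => forall n, x n < u) lt_wf) as [b [Hb1 Hb2]]; [eauto|].
    exists b. split; [split|].
    + apply (le_lt_tr Ha). apply (Hb1 0%nat).
    + intros c Hc. apply NNPP. intros N.
      assert (Hn : exists n, c <= x n).
      { apply NNPP. intros N'. apply (Hb2 c Hc). intros n. apply nle_lt. eauto. }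
      destruct Hn as [n Hn]. apply N. apply (@lt_tr _ (x (S n))); auto.
      simpl. apply Hh'. auto.
    + apply (le_lt_tr Hd). apply (Hb1 0%nat).
  - intros b Hb [z Hz].
    assert (Hc : forall c, c < b -> exists d, c < d /\ d < b /\ a < d /\ forall c, c < d -> g c < d).
    { intros c Hcb. apply NNPP. intros N. apply (lt_irr (a:=b)).
      refine (le_lt_tr _ Hcb). apply Hb. intros x [[H1 H2] H3].
      apply nlt_le. intros H. apply N. exists x. auto. }
    split.
    + destruct (Hc z Hz) as (d & _ & H1 & H2 & _). eauto using lt_tr.
    + intros c Hcb. destruct (Hc c Hcb) as (d & H1 & H2 & _ & H3). eauto using lt_tr.
Qed.

End Cardinal.

Arguments lt_irr {K lt} HK {a} _.
Arguments lt_tr {K lt} HK {a b c} _ _.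
Arguments lt_tot {K lt} HK a b.
Arguments le_lt_tr {K lt} HK {a b c} _ _.
Arguments lt_le_tr {K lt} HK {a b c} _ _.
Arguments le_tr {K lt} HK {a b c} _ _.
Arguments le_antisym {K lt} HK {a b} _ _.
Arguments nlt_le {K lt} HK {a b}.
Arguments nle_lt {K lt} HK {a b}.
Arguments small_seg {K lt} HK a _.

(** * Trees with a level function *)

Section Leveled.
Variables (K : Type) (lt : K -> K -> Prop).
Hypothesis HK : regular_uncountable_cardinal lt.

(** If [f] and [g] realise heights [a < b], induction on [c < b] shows that [f] sends the
    predecessor that [g] puts at [c] to at least [c]; at [c = a] this is impossible. *)
Lemma height_unique (X : Type) (R : X -> X -> Prop) x a b :
  height lt R x a -> height lt R x b -> a = b.
Proof.
  assert (H : forall a b, height lt R x a -> height lt R x b -> ~ lt a b).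
  { clear a b. intros a b (f & Hf1 & Hf2) (g & Hg1 & Hg2) Hab.
    assert (Hh : forall c, lt c b -> exists u, proj1_sig (g u) = c /\ ~ lt (proj1_sig (f u)) c).
    { intros c. induction c as [c IH] using (well_founded_induction (lt_wf HK)). intros Hc.
      destruct (Hg2 (exist _ c Hc)) as [u Hu]. exists u. rewrite Hu. split; auto. intros N.
      destruct (IH _ N (lt_tr HK N Hc)) as (v & Hv1 & Hv2). apply Hv2.
      apply Hf1, Hg1. rewrite Hu, Hv1. exact N. }
    destruct (Hh a Hab) as (u & _ & Hu). apply Hu. exact (proj2_sig (f u)). }
  intros Ha Hb. destruct (lt_tot HK a b) as [|[|]]; auto; [destruct (H a b)|destruct (H b a)]; auto.
Qed.

Variables (X : Type) (R : X -> X -> Prop) (lev : X -> K).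
Hypothesis R_trans : forall x y z, R x y -> R y z -> R x z.
Hypothesis R_lev : forall x y, R x y -> lt (lev x) (lev y).
Hypothesis R_restr : forall y d, lt d (lev y) -> exists x, R x y /\ lev x = d.
Hypothesis R_below : forall x y z, R x z -> R y z -> lt (lev x) (lev y) -> R x y.
Hypothesis R_unique : forall x y z, R x z -> R y z -> lev x = lev y -> x = y.

Lemma leveled_tree : is_tree R.
Proof.
  split; [|split; [|split]].
  - intros x H. exact (lt_irr HK (R_lev H)).
  - exact R_trans.
  - intros x y z Hy Hz. destruct (lt_tot HK (lev y) (lev z)) as [H|[H|H]]; eauto.
  - intros x. apply (wf_incl _ _ (fun u v : {y | R y x} => lt (lev (proj1_sig u)) (lev (proj1_sig v)))).
    + intros u v H. apply R_lev, H.
    + apply (wf_inverse_image _ _ lt (fun u : {y | R y x} => lev (proj1_sig u))), (lt_wf HK).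
Qed.

(** Sending a predecessor to its level is an isomorphism onto the ordinals below the level, so for
    the constructed trees [height] reduces to [lev]. *)
Lemma leveled_height x a : height lt R x a <-> lev x = a.
Proof.
  assert (H : height lt R x (lev x)).
  { exists (fun u : {y | R y x} => exist (fun b => lt b (lev x)) (lev (proj1_sig u)) (R_lev (proj2_sig u))).
    split.
    - intros [u Hu] [v Hv]; simpl. split; eauto.
    - intros [d Hd]. destruct (R_restr Hd) as (y & Hy & E). exists (exist _ y Hy).
      apply sig_eq. exact E. }
  split; [|intros <-; auto]. intros H'. exact (height_unique H H').
Qed.

Lemma leveled_kappa_tree : (forall a, exists x, lev x = a) ->
  (forall a, small K {x | lev x = a}) -> kappa_tree lt R.
Proof.
  intros H1 H2. split; [apply leveled_tree|]. split; [|split].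
  - intros x. exists (lev x). apply leveled_height; auto.
  - intros a. destruct (H1 a) as [x Hx]. exists x. apply leveled_height; auto.
  - intros a. refine (small_inj _ (H2 a)).
    exists (fun u : {x | height lt R x a} => exist (fun x => lev x = a) (proj1_sig u)
      (proj1 (leveled_height _ _) (proj2_sig u))).
    intros u v E. apply sig_eq. exact (f_equal (@proj1_sig _ _) E).
Qed.

End Leveled.

(** * The coherent system of names and projections *)

Section Construction.
Variables (K : Type) (lt : K -> K -> Prop).
Hypothesis HK : regular_uncountable_cardinal lt.

Notation "a < b" := (lt a b).
Notation "a <= b" := (le lt a b).

Definition trunc (Y : Type) (d : Y) (f : K -> Y) (a b : K) : Y :=
  if lt_dec lt b a then f b else d.

Lemma trunc_lt (Y : Type) (d : Y) f a b : b < a -> trunc d f a b = f b.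
Proof. unfold trunc. destruct lt_dec; tauto. Qed.

(** The history is passed as a total function with default value [d] from [a] on. Hence functionals
    take no proofs as arguments, and the unfolding equation holds for every [F]. *)
Definition wfrec (Y : Type) (d : Y) (F : K -> (K -> Y) -> Y) : K -> Y :=
  Fix (lt_wf HK) (fun _ => Y)
    (fun a rec => F a (fun b => match lt_dec lt b a with left h => rec b h | right _ => d end)).

Lemma wfrec_eq (Y : Type) (d : Y) F a : wfrec d F a = F a (trunc d (wfrec d F) a).
Proof.
  unfold wfrec at 1. rewrite Fix_eq.
  - f_equal.
  - intros x f g E. f_equal. extensionality b. destruct lt_dec; auto.
Qed.

(* The names of the nodes of level [a]: descending lists of ordinals below [a]
   ending in the least ordinal.  The node named [g :: l] is the limit of the path that
   starts in the node named [l] of level [g]. *)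
Fixpoint valid (a : K) (l : list K) : Prop :=
  match l with
  | nil => forall b, ~ b < a
  | g :: l' => g < a /\ valid g l'
  end.

Lemma valid_Forall a l : valid a l -> Forall (fun b => b < a) l.
Proof.
  revert a. induction l as [|g l IH]; intros a; simpl; auto.
  intros [H1 H2]. constructor; auto.
  eapply Forall_impl; [|apply IH, H2]. intros b Hb. exact (lt_tr HK Hb H1).
Qed.

Lemma small_valid a : small K {l | valid a l}.
Proof.
  refine (small_inj _ (small_list HK (small_seg HK a))).
  exists (fun u : {l | valid a l} => exist _ (proj1_sig u) (valid_Forall _ _ (proj2_sig u))).
  intros u v E. apply sig_eq. exact (f_equal (@proj1_sig _ _) E).
Qed.

(* [rep a j] is the chosen representative of the branches that agree with [j] below [a]. *)
Variables (J : Type) (rep : K -> J -> J) (C : K -> K -> Prop).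
(** [Guess b] is the set decoded from the diamond at [b]. Its elements are levels with a finite list
    of triples: a branch representative, a node name of that level, and the name of a path. *)
Variable Guess : K -> K * list (J * list K * list K) -> Prop.

Hypothesis rep_le : forall a b j, a <= b -> rep a (rep b j) = rep a j.
Hypothesis C_lt : forall a b, C a b -> b < a.
Hypothesis C_closed : forall a b, b < a -> is_sup lt (fun x => C a x /\ x < b) b ->
  (exists z, z < b) -> C a b.
Hypothesis C_sup : forall a, exists s, is_sup lt (fun b => b < a) s /\ is_sup lt (C a) s.
Hypothesis C_coh : forall a b, acc lt (C a) b -> forall x, C b x <-> C a x /\ x < b.

Notation levelmap := (J -> list K -> K -> list K).

Definition on_path (c : K -> Prop) (g x : K) : Prop := x = g \/ (c x /\ g < x).

(** The predecessor of [b] on the path starting at [g]. It is meant for [b] on the path beyond [g]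
    and outside the accumulation points, where the maximum exists; elsewhere the value is
    arbitrary. *)
Definition pre (c : K -> Prop) (b g : K) : K :=
  epsilon (inhabits b)
    (fun x => on_path c g x /\ x < b /\ forall y, on_path c g y -> y < b -> y <= x).

(** * One step of a path *)

Section Step.
(* An entry [(j, y, l)] of a tuple stands for the path named [l] in the tree of [j], whose
   position at level [b] is [y].  [P] projects level [b] to the levels below, [p g] is the predecessor of [b] in the path
   starting at [g], and [prev] gives the positions already reached. *)
Variables (b : K) (P : levelmap) (p : K -> K) (prev : K -> J -> list K -> list K).

(** The admissible next positions. The head of a name is the level where its path starts, so
    [hd b l] is the starting level whenever [l] is not empty. *)
Definition extends (j : J) (l y : list K) : Prop :=
  valid b y /\ P (rep b j) y (p (hd b l)) = prev (p (hd b l)) j l.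

Definition restr (d : K) (e : J * list K * list K) : J * list K * list K :=
  let '(j, y, l) := e in (rep d j, P (rep b j) y d, l).

(** The guess at [b] only concerns levels below [b], so a tuple of level [b] is tested through its
    restrictions to a final segment of these levels. *)
Definition sealed (w : list (J * list K * list K)) : Prop :=
  (forall j y l, In (j, y, l) w -> extends j l y /\ hd b l < b) /\
  exists d0, d0 < b /\ forall d, d0 <= d -> d < b -> Guess b (d, map (restr d) w).

(* The choice of the tuple does not depend on [j], hence is shared by all branches. *)
Definition hit (j : J) (l y : list K) : Prop :=
  exists j', In (j', y, l) (epsilon (inhabits nil) sealed) /\ rep b j' = rep b j.

(** An admissible position in the chosen sealed tuple is preferred; if there is none, any admissible
    position will do. *)
Definition next (j : J) (l : list K) : list K :=
  epsilon (inhabits nil)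
    (fun y => extends j l y /\ ((exists z, extends j l z /\ hit j l z) -> hit j l y)).

(** At its start the path is at the node named by the tail. At an accumulation point [b], coherence
    makes the path so far the one that [l] names at level [b], so the position is [l] itself. *)
Definition pos_step (isacc : Prop) (j : J) (l : list K) : list K :=
  if excluded_middle_informative (b = hd b l) then tl l
  else if excluded_middle_informative isacc then l else next j l.

End Step.

Definition pos_rec (P : K -> levelmap) (c : K -> Prop) : K -> J -> list K -> list K :=
  wfrec (fun _ _ => nil)
    (fun b rec => pos_step b (P b) (pre c b) (fun x j l => rec x (rep x j) l) (acc lt c b)).

Lemma pre_ext c c' b : (forall x, x <= b -> (c x <-> c' x)) -> pre c b = pre c' b.
Proof.
  intros H. extensionality g. unfold pre. f_equal. extensionality x.
  assert (E : forall x, x < b -> (on_path c g x <-> on_path c' g x)).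
  { intros y Hy. unfold on_path. rewrite (H y); [tauto|left; auto]. }
  apply propositional_extensionality. split; intros (H1 & H2 & H3);
    (split; [apply E; auto|split; auto]); intros y Hy1 Hy2; apply H3; auto; apply E; auto.
Qed.

Lemma acc_ext c c' b : (forall x, x <= b -> (c x <-> c' x)) -> acc lt c b -> acc lt c' b.
Proof.
  intros H (H1 & (H2 & H3) & H4).
  refine (conj _ (conj (conj _ _) H4)).
  - apply H; auto.
  - intros x [Hx1 Hx2]. left; auto.
  - intros t Ht. apply H3. intros x [Hx1 Hx2]. apply Ht. split; auto. apply H; auto.
Qed.

(** Positions at [b] see projections and the club only up to [b]. This permits truncated projections
    in the recursion over levels, and it lets coherent clubs share their paths. *)
Lemma pos_ext P P' c c' b :
  (forall a, a <= b -> P a = P' a) -> (forall x, x <= b -> (c x <-> c' x)) ->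
  pos_rec P c b = pos_rec P' c' b.
Proof.
  induction b as [b IH] using (well_founded_induction (lt_wf HK)).
  intros HP Hc. unfold pos_rec. rewrite !wfrec_eq. fold (pos_rec P c) (pos_rec P' c').
  rewrite (HP b), (pre_ext c c'); auto; [|right; auto].
  replace (acc lt c b) with (acc lt c' b).
  2:{ apply propositional_extensionality. split; apply acc_ext; auto. intros. symmetry; auto. }
  f_equal. extensionality x. extensionality j. extensionality l.
  unfold trunc. destruct lt_dec as [H|H]; auto. rewrite IH; auto.
  - intros a Ha. apply HP. left. exact (le_lt_tr HK Ha H).
  - intros a Ha. apply Hc. left. exact (le_lt_tr HK Ha H).
Qed.

(** * Projections and positions *)

Definition at_level (P : K -> levelmap) (b : K) (j : J) (y : list K) (d : K) : list K :=
  if excluded_middle_informative (d = b) then y else P b (rep b j) y d.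

(** To reach level [d], follow the path to some element [b] at or above [d] and project its position
    there. Independence of the choice of [b] is shown in [all_level_ok]. *)
Definition proj_rec : K -> levelmap :=
  wfrec (fun _ _ _ => nil) (fun a P j l d =>
    let b := epsilon (inhabits a) (fun b => on_path (C a) (hd a l) b /\ d <= b /\ b < a) in
    at_level P b j (pos_rec P (C a) b (rep b j) l) d).

Definition proj (a : K) (j : J) (l : list K) (d : K) : list K := proj_rec a (rep a j) l d.

Definition pos (c : K -> Prop) (b : K) (j : J) (l : list K) : list K :=
  pos_rec proj_rec c b (rep b j) l.

Definition projle (b : K) (j : J) (y : list K) (d : K) : list K :=
  if excluded_middle_informative (d = b) then y else proj b j y d.

Lemma projle_eq b j y : projle b j y b = y.
Proof. unfold projle. destruct excluded_middle_informative; tauto. Qed.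

Lemma projle_lt b j y d : d < b -> projle b j y d = proj b j y d.
Proof.
  unfold projle. destruct excluded_middle_informative; auto.
  subst. intros H. destruct (lt_irr HK H).
Qed.

Lemma rep_idem a j : rep a (rep a j) = rep a j.
Proof. apply rep_le. right; auto. Qed.

Lemma rep_eq_le a b j j' : a <= b -> rep b j = rep b j' -> rep a j = rep a j'.
Proof. intros H E. rewrite <- (rep_le j H), E. auto. Qed.

Lemma proj_rep a j j' l d : rep a j = rep a j' -> proj a j l d = proj a j' l d.
Proof. unfold proj. intros ->; auto. Qed.

Lemma pos_rep c b j j' l : rep b j = rep b j' -> pos c b j l = pos c b j' l.
Proof. unfold pos. intros ->; auto. Qed.

Lemma pos_congr c c' b j l : (forall x, x <= b -> (c x <-> c' x)) -> pos c b j l = pos c' b j l.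
Proof. intros H. unfold pos. rewrite (@pos_ext proj_rec proj_rec c c'); auto. Qed.

Definition prevpos c b x j l : list K :=
  trunc (fun _ _ => nil) (pos_rec proj_rec c) b x (rep x j) l.

Lemma prevpos_lt c b x j l : x < b -> prevpos c b x j l = pos c x j l.
Proof. intros H. unfold prevpos. rewrite trunc_lt; auto. Qed.

Lemma pos_eq c b j l :
  pos c b j l = pos_step b (proj_rec b) (pre c b) (prevpos c b) (acc lt c b) (rep b j) l.
Proof. unfold pos. unfold pos_rec at 1. rewrite wfrec_eq. reflexivity. Qed.

Lemma pos_start c g j l : pos c g j (g :: l) = l.
Proof.
  rewrite pos_eq. unfold pos_step; simpl. destruct excluded_middle_informative; tauto.
Qed.

Lemma pos_acc c b j g l : g < b -> acc lt c b -> pos c b j (g :: l) = g :: l.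
Proof.
  intros H1 H2. rewrite pos_eq. unfold pos_step; simpl.
  destruct excluded_middle_informative; [subst; destruct (lt_irr HK H1)|].
  destruct excluded_middle_informative; tauto.
Qed.

Lemma pos_nacc c b j g l :
  g < b -> ~ acc lt c b -> pre c b g < b ->
  (exists y, valid b y /\ proj b j y (pre c b g) = pos c (pre c b g) j (g :: l)) ->
  let ok y := valid b y /\ proj b j y (pre c b g) = pos c (pre c b g) j (g :: l) in
  let ht := hit b (proj_rec b) (pre c b) (prevpos c b) j (g :: l) in
  ok (pos c b j (g :: l)) /\ ((exists z, ok z /\ ht z) -> ht (pos c b j (g :: l))).
Proof.
  intros H1 H2 H3 H4 ok ht. rewrite pos_eq. unfold pos_step; simpl.
  destruct excluded_middle_informative; [subst; destruct (lt_irr HK H1)|].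
  destruct excluded_middle_informative; [tauto|].
  assert (Eok : forall y, extends b (proj_rec b) (pre c b) (prevpos c b) (rep b j) (g :: l) y <-> ok y).
  { intros y. unfold extends, ok. simpl. rewrite prevpos_lt, rep_idem; auto.
    rewrite (@pos_rep c (pre c b g) (rep b j) j).
    - reflexivity.
    - apply rep_le. left; auto. }
  assert (Eht : forall y, hit b (proj_rec b) (pre c b) (prevpos c b) (rep b j) (g :: l) y <-> ht y).
  { intros y. unfold hit, ht. unfold hit. rewrite rep_idem. reflexivity. }
  match goal with |- ok ?t /\ _ => assert (E : ok t /\ ((exists z, ok z /\ ht z) -> ht t)) end; [|exact E].
  unfold next. match goal with |- context [epsilon ?i ?Q] => assert (HQ : Q (epsilon i Q)) end.
  - apply epsilon_spec. destruct (classic (exists z, ok z /\ ht z)) as [[z [Hz1 Hz2]]|N].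
    + exists z. split; [apply Eok; auto|]. intros _. apply Eht; auto.
    + destruct H4 as [y Hy]. exists y. split; [apply Eok; auto|].
      intros [z [Hz1 Hz2]]. destruct N. exists z. split; [apply Eok|apply Eht]; auto.
  - destruct HQ as [HQ1 HQ2]. split; [apply Eok; auto|].
    intros [z [Hz1 Hz2]]. apply Eht, HQ2. exists z. split; [apply Eok|apply Eht]; auto.
Qed.

(** * Cofinality and predecessors along the clubs *)

(** If all of [C a] lay below [d], then [d] would be its supremum, as this is also the supremum of
    the ordinals below [a]; closure would then put [d] into [C a]. *)
Lemma C_cof a d : d < a -> (exists z, z < d) -> exists c, C a c /\ d <= c.
Proof.
  intros Hd Hz. apply NNPP. intros N.
  assert (Hlt : forall c, C a c -> c < d).
  { intros c Hc. apply NNPP. intros H. apply N. exists c. split; auto. apply (nlt_le HK); auto. }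
  destruct (C_sup a) as [s [[S1 S2] [S3 S4]]].
  assert (s = d).
  { apply (le_antisym HK); [|apply S1; auto]. apply S4. intros x Hx. left; auto. }
  subst s. apply (lt_irr HK (a:=d)), Hlt, C_closed; auto.
  split.
  - intros x [_ H]. left; auto.
  - intros t Ht. apply S4. intros x Hx. apply Ht. auto.
Qed.

Lemma on_path_cof a g d : g < a -> d < a -> exists b, on_path (C a) g b /\ d <= b /\ b < a.
Proof.
  intros Hg Hd. destruct (classic (g < d)) as [H|H].
  - destruct (@C_cof a d Hd) as [c [Hc1 Hc2]]; [eauto|]. exists c. split; [right|split]; auto.
    split; auto. exact (lt_le_tr HK H Hc2).
  - exists g. split; [left; auto|]. split; auto. apply (nlt_le HK); auto.
Qed.

Lemma proj_eq a j g l d : g < a -> d < a ->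
  exists b, on_path (C a) g b /\ d <= b /\ b < a /\
    proj a j (g :: l) d = projle b j (pos (C a) b j (g :: l)) d.
Proof.
  intros Hg Hd. unfold proj at 1. unfold proj_rec. rewrite wfrec_eq. fold proj_rec. simpl.
  set (b := epsilon _ _).
  assert (Hb : on_path (C a) g b /\ d <= b /\ b < a).
  { apply epsilon_spec, on_path_cof; auto. }
  clearbody b. exists b. destruct Hb as (H1 & H2 & H3). repeat (split; auto).
  assert (Hr : rep b (rep a j) = rep b j) by (apply rep_le; left; auto).
  unfold at_level, projle. rewrite trunc_lt; auto. rewrite Hr.
  destruct excluded_middle_informative.
  - unfold pos. rewrite (@pos_ext (trunc (fun _ _ _ => nil) proj_rec a) proj_rec (C a) (C a)); try tauto.
    intros x Hx. apply trunc_lt. exact (le_lt_tr HK Hx H3).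
  - unfold proj, pos. rewrite (@pos_ext (trunc (fun _ _ _ => nil) proj_rec a) proj_rec (C a) (C a)); try tauto.
    intros x Hx. apply trunc_lt. exact (le_lt_tr HK Hx H3).
Qed.

(** As [b] is not an accumulation point, the path below [b] is bounded strictly below [b]. Its least
    upper bound [s] lies on the path because [C a] is closed. *)
Lemma pre_spec a g b : on_path (C a) g b -> b < a -> g < b -> ~ acc lt (C a) b ->
  let p := pre (C a) b g in
  on_path (C a) g p /\ p < b /\ forall y, on_path (C a) g y -> y < b -> y <= p.
Proof.
  intros Hb Hba Hg Hn. unfold pre. apply epsilon_spec.
  destruct Hb as [->|[Hb _]]; [destruct (lt_irr HK Hg)|].
  set (S x := on_path (C a) g x /\ x < b).
  assert (Sg : S g) by (split; auto; left; auto).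
  assert (Ht : exists t, t < b /\ forall x, S x -> x <= t).
  { apply NNPP. intros N. apply Hn. split; [|split; [split|]]; eauto.
    - intros x [_ H]; left; auto.
    - intros t Ht. apply (nlt_le HK). intros H. apply N.
      destruct (classic (t < g)) as [H'|H'].
      + exists g. split; auto. intros x [[->|[Hx1 Hx3]] Hx2]; [right; auto|].
        apply (le_tr HK (b:=t)); [apply Ht; auto|left; auto].
      + exists t. split; auto. intros x [[->|[Hx1 Hx3]] Hx2]; [apply (nlt_le HK); auto|]. auto. }
  destruct (wf_least (fun t => t < b /\ forall x, S x -> x <= t) (lt_wf HK) Ht)
    as [s [[S1 S2] S3]].
  assert (S4 : forall t, t < s -> exists x, S x /\ t < x).
  { intros t H. apply NNPP. intros N. apply (S3 t H). split; [exact (lt_tr HK H S1)|].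
    intros x Hx. apply (nlt_le HK). eauto. }
  exists s. assert (Hs : on_path (C a) g s).
  { apply NNPP. intros N.
    assert (Slt : forall x, S x -> x < s).
    { intros x Hx. destruct (S2 x Hx) as [|E]; auto. destruct N. rewrite <- E. apply Hx. }
    apply N. right. split; [|auto]. apply C_closed; [exact (lt_tr HK S1 Hba)| |eauto]. split.
    - intros x [_ H]; left; auto.
    - intros t Ht'. apply (nlt_le HK). intros H.
      assert (Hgt : ~ t < g).
      { intros H'. destruct (S4 g) as [x [Hx1 Hx2]]; auto.
        destruct (proj1 Hx1) as [->|[Hx3 _]]; [destruct (lt_irr HK Hx2)|].
        assert (x <= t) by auto. apply (lt_irr HK (a:=g)).
        exact (lt_tr HK (lt_le_tr HK Hx2 H0) H'). }
      destruct (S4 t H) as [x [Hx1 Hx2]].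
      destruct (proj1 Hx1) as [->|[Hx3 _]]; [tauto|].
      apply (lt_irr HK (a:=t)). apply (lt_le_tr HK Hx2). auto. }
  split; auto. split; auto. intros y Hy1 Hy2. apply S2. split; auto.
Qed.

(** * Correctness of the recursion *)

(** The induction invariant: projections are names, they compose, and the node named [g :: l] lies
    above every position of its path. *)
Definition level_ok a : Prop := forall j g l, g < a -> valid g l ->
  (forall d, d < a -> valid d (proj a j (g :: l) d)) /\
  (forall d e, e < d -> d < a -> proj d j (proj a j (g :: l) d) e = proj a j (g :: l) e) /\
  (forall b, on_path (C a) g b -> b < a -> proj a j (g :: l) b = pos (C a) b j (g :: l)).

(** Induction along the path. Accumulation points use coherence and the invariant at [b]; at other
    points the predecessor is handled by induction and the step moves above it. *)
Lemma path_ok a j g l : g < a -> valid g l -> (forall b, b < a -> level_ok b) ->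
  forall b, on_path (C a) g b -> b < a ->
  valid b (pos (C a) b j (g :: l)) /\
  (forall d, on_path (C a) g d -> d < b ->
     proj b j (pos (C a) b j (g :: l)) d = pos (C a) d j (g :: l)) /\
  (g < b -> ~ acc lt (C a) b ->
   let ok y := valid b y /\
     proj b j y (pre (C a) b g) = pos (C a) (pre (C a) b g) j (g :: l) in
   let ht := hit b (proj_rec b) (pre (C a) b) (prevpos (C a) b) j (g :: l) in
   (exists z, ok z /\ ht z) -> ok (pos (C a) b j (g :: l)) /\ ht (pos (C a) b j (g :: l))).
Proof.
  intros Hg Hl Hok b. induction b as [b IH] using (well_founded_induction (lt_wf HK)).
  intros Hb Hba.
  assert (Hgb : g = b \/ g < b).
  { destruct Hb as [->|[_ ?]]; auto. }
  destruct Hgb as [<-|Hgb].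
  { rewrite pos_start. split; [|split]; auto.
    - intros d [->|[_ H]] H'; [destruct (lt_irr HK H')|destruct (lt_irr HK (lt_tr HK H H'))].
    - intros H'. destruct (lt_irr HK H'). }
  destruct (classic (acc lt (C a) b)) as [Ha|Hn].
  { rewrite pos_acc; auto. split; [simpl; auto|]. split; [|tauto]. intros d Hd Hdb.
    destruct (Hok b Hba j g l Hgb Hl) as (_ & _ & H4).
    rewrite H4; auto.
    - apply pos_congr. intros x Hx. rewrite (C_coh Ha). split; [tauto|]. intros; split; auto.
      exact (le_lt_tr HK Hx Hdb).
    - destruct Hd as [->|[Hd ?]]; [left; auto|right; split; auto]. apply (C_coh Ha); auto. }
  destruct (pre_spec Hb Hba Hgb Hn) as (P1 & P2 & P3).
  destruct (IH _ P2 P1 (lt_tr HK P2 Hba)) as (I1 & I2 & _).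
  destruct (pos_nacc j l Hgb Hn P2) as [[Q1 Q2] Q3].
  (* An extension always exists: the node of level [b] whose path starts in the position [y] already
     reached. *)
  { set (y := pos _ _ _ _) in *. exists (pre (C a) b g :: y). simpl. split; auto.
    destruct (Hok b Hba j _ y P2 I1) as (_ & _ & H4).
    rewrite H4; auto; [apply pos_start|left; auto]. }
  split; [|split]; [exact Q1| |intros _ _ ok ht He; exact (conj (conj Q1 Q2) (Q3 He))].
  intros d Hd Hdb.
  destruct (P3 d Hd Hdb) as [H|H]; [|subst d; auto].
  set (y := pos (C a) b j (g :: l)) in *.
  assert (Hy : exists g' l', y = g' :: l').
  { destruct y as [|g' l']; eauto. destruct (Q1 _ Hdb). }
  destruct Hy as (g' & l' & Ey). rewrite Ey in *. destruct Q1 as [Q11 Q12].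
  destruct (Hok b Hba j g' l' Q11 Q12) as (_ & H2 & _).
  rewrite <- (H2 (pre (C a) b g) d); auto. rewrite Q2; auto.
Qed.

Lemma all_level_ok a : level_ok a.
Proof.
  induction a as [a IH] using (well_founded_induction (lt_wf HK)).
  intros j g l Hg Hl.
  assert (Hp := fun b Hb Hba => @path_ok a j g l Hg Hl IH b Hb Hba).
  set (q b := pos (C a) b j (g :: l)) in *.
  assert (Hle : forall b d, on_path (C a) g b -> b < a -> d <= b ->
            valid d (projle b j (q b) d)).
  { intros b d Hb Hba [Hd| ->]; [|rewrite projle_eq; exact (proj1 (Hp b Hb Hba))].
    rewrite projle_lt; auto.
    assert (V : valid b (q b)) by exact (proj1 (Hp b Hb Hba)). destruct (q b) as [|g' l']; [destruct (V _ Hd)|].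
    destruct V. apply IH; auto. }
  assert (Htr : forall b d e, on_path (C a) g b -> b < a -> d <= b -> e < d ->
            proj d j (projle b j (q b) d) e = proj b j (q b) e).
  { intros b d e Hb Hba [Hd| ->] He; [|rewrite projle_eq; auto].
    rewrite projle_lt; auto.
    assert (V : valid b (q b)) by exact (proj1 (Hp b Hb Hba)). destruct (q b) as [|g' l']; [destruct (V _ Hd)|].
    destruct V. apply IH; auto. }
  (* Any two elements of the path yield the same projection, so the choice made in [proj_rec] is
     immaterial. *)
  assert (Hun : forall b b' d, on_path (C a) g b -> b < a -> on_path (C a) g b' -> b' < a ->
            d <= b -> b < b' -> projle b' j (q b') d = projle b j (q b) d).
  { intros b b' d Hb Hba Hb' Hba' Hd Hbb'.
    rewrite projle_lt; [|exact (le_lt_tr HK Hd Hbb')].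
    assert (E : proj b' j (q b') b = q b) by exact (proj1 (proj2 (Hp b' Hb' Hba')) b Hb Hbb').
    destruct Hd as [Hd| ->].
    - rewrite projle_lt; auto. rewrite <- E. rewrite <- (Htr b' b d); auto; [|left; auto].
      rewrite projle_lt; auto.
    - rewrite projle_eq; auto. }
  assert (Hpr : forall b d, on_path (C a) g b -> b < a -> d <= b ->
            proj a j (g :: l) d = projle b j (q b) d).
  { intros b d Hb Hba Hd.
    destruct (@proj_eq a j g l d Hg (le_lt_tr HK Hd Hba)) as (b' & Hb' & Hd' & Hba' & ->).
    fold (q b').
    destruct (lt_tot HK b b') as [H|[H|H]]; [|subst; auto|symmetry]; auto. }
  split; [|split].
  - intros d Hd. destruct (on_path_cof Hg Hd) as (b & Hb & Hdb & Hba).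
    rewrite (Hpr b d); auto.
  - intros d e He Hd. destruct (on_path_cof Hg Hd) as (b & Hb & Hdb & Hba).
    rewrite (Hpr b d), (Hpr b e), Htr; auto; [|left; exact (lt_le_tr HK He Hdb)].
    rewrite projle_lt; auto. exact (lt_le_tr HK He Hdb).
  - intros b Hb Hba. rewrite (Hpr b b); auto; [apply projle_eq|right; auto].
Qed.

Lemma proj_valid a j l d : valid a l -> d < a -> valid d (proj a j l d).
Proof.
  intros Hl Hd. destruct l as [|g l]; [destruct (Hl _ Hd)|]. destruct Hl.
  apply all_level_ok; auto.
Qed.

Lemma proj_proj a j l d e : valid a l -> e < d -> d < a -> proj d j (proj a j l d) e = proj a j l e.
Proof.
  intros Hl He Hd. destruct l as [|g l]; [destruct (Hl _ Hd)|]. destruct Hl.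
  apply all_level_ok; auto.
Qed.

Lemma proj_pos a j g l b : valid a (g :: l) -> on_path (C a) g b -> b < a ->
  proj a j (g :: l) b = pos (C a) b j (g :: l).
Proof. intros [H1 H2]. intros. apply all_level_ok; auto. Qed.

Lemma proj_cons a j d l : d < a -> valid d l -> proj a j (d :: l) d = l.
Proof.
  intros Hd Hl. rewrite proj_pos; auto; [apply pos_start|simpl; auto|left; auto].
Qed.

Lemma pos_sealed a j g l b : valid a (g :: l) -> on_path (C a) g b -> b < a ->
  g < b -> ~ acc lt (C a) b ->
  let ok y := valid b y /\
     proj b j y (pre (C a) b g) = pos (C a) (pre (C a) b g) j (g :: l) in
  let ht := hit b (proj_rec b) (pre (C a) b) (prevpos (C a) b) j (g :: l) in
  (exists z, ok z /\ ht z) -> ht (proj a j (g :: l) b).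
Proof.
  intros H Hb Hba Hg Hn ok ht He. rewrite proj_pos; auto.
  destruct H as [H1 H2].
  apply (@path_ok a j g l H1 H2 (fun b _ => @all_level_ok b) b Hb Hba); auto.
Qed.

(** * Hypotheses on branches and guesses *)

Hypothesis rep_lim : forall a j j', (forall b, b < a -> exists c, b < c /\ c < a) ->
  (forall b, b < a -> rep b j = rep b j') -> rep a j = rep a j'.
Hypothesis rep_sep : forall j j', (forall a, rep a j = rep a j') -> j = j'.
Hypothesis C_guess : forall B : K -> K -> Prop, (forall i, unbounded lt (B i)) ->
  stationary lt (fun a => forall i, i < a -> forall n : nat,
    is_sup lt (fun b => C a b /\
      forall d, suc lt n (fun x => C a x /\ b <= x) d -> B i d) a).

(** Only representatives and valid names of the level occur, so each level has fewer than kappa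
    normal tuples and they can be coded by ordinals. *)
Definition normal (z : K * list (J * list K * list K)) : Prop :=
  Forall (fun e => rep (fst z) (fst (fst e)) = fst (fst e) /\
    valid (fst z) (snd (fst e)) /\ valid (fst z) (snd e)) (snd z).

Variable code : K * list (J * list K * list K) -> K.
Hypothesis code_inj : forall z z', normal z -> normal z' -> code z = code z' -> z = z'.
Hypothesis code_bound : exists g : K -> K, forall z, normal z -> code z < g (fst z).
Hypothesis Guess_unbounded : forall (Z : K * list (J * list K * list K) -> Prop) (g : K -> K) a,
  (forall z, Z z -> normal z) ->
  unbounded lt (fun b => (a < b /\ forall c, c < b -> g c < b) /\
    forall z, Guess b z <-> Z z /\ fst z < b).

(** * Sealing dense open sets *)

Section Sealing.
Variables (I : Type) (iota : I -> J) (l : list I) (D : K -> (I -> list K) -> Prop).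

Definition tuple (d : K) (y : I -> list K) : Prop := forall i, In i l -> valid d (y i).

Definition above (d : K) (y : I -> list K) (d' : K) (y' : I -> list K) : Prop :=
  forall i, In i l -> projle d' (iota i) (y' i) d = y i.

Hypothesis iota_inj : forall i i', iota i = iota i' -> i = i'.
Hypothesis D_dense : forall d y, tuple d y ->
  exists d' y', d < d' /\ tuple d' y' /\ above d y d' y' /\ D d' y'.
Hypothesis D_open : forall d y d' y', D d y -> d <= d' -> tuple d' y' -> above d y d' y' -> D d' y'.

(** Two distinct branches differ at some level and at all later ones, and finitely many such levels
    have a common bound. *)
Lemma separation_level : exists s, forall i i', In i l -> In i' l ->
  rep s (iota i) = rep s (iota i') -> i = i'.
Proof.
  assert (H : forall p : {i | In i l} * {i | In i l}, exists a,
    rep a (iota (proj1_sig (fst p))) = rep a (iota (proj1_sig (snd p))) ->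
    proj1_sig (fst p) = proj1_sig (snd p)).
  { intros [[i Hi] [i' Hi']]; simpl. apply NNPP. intros N.
    destruct (inhabited_K HK) as [a].
    apply N. exists a. intros _. apply iota_inj, rep_sep. intros b. apply NNPP.
    intros N'. apply N. exists b. tauto. }
  destruct (small_range_bounded HK
    (fun p => proj1_sig (constructive_indefinite_description _ (H p)))
    (small_prod HK (small_In HK l) (small_In HK l))) as [s Hs].
  exists s. intros i i' Hi Hi' E.
  specialize (Hs (exist _ i Hi, exist _ i' Hi')).
  destruct constructive_indefinite_description as [a Ha]; simpl in *.
  apply Ha. apply (rep_eq_le (b := s)); auto. left; auto.
Qed.

(** On [l], level [d] carries fewer than kappa tuples, each determined by the list [map y l], so the
    levels of chosen extensions in [D] are bounded. *)
Lemma density_bound : exists g : K -> K, forall d y, tuple d y ->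
  exists d' y', d < d' /\ d' < g d /\ tuple d' y' /\ above d y d' y' /\ D d' y'.
Proof.
  assert (H : forall d, exists u, forall y, tuple d y ->
    exists d' y', d < d' /\ d' < u /\ tuple d' y' /\ above d y d' y' /\ D d' y').
  { intros d.
    assert (Hf : forall v : {v | Forall (fun x => valid d x) v}, exists d', forall y, tuple d y ->
      map y l = proj1_sig v -> exists y', d < d' /\ tuple d' y' /\ above d y d' y' /\ D d' y').
    { intros [v Hv]; simpl.
      destruct (classic (exists y, tuple d y /\ map y l = v)) as [[y [Hy Ey]]|N].
      - destruct (D_dense Hy) as (d' & y' & H1 & H2 & H3 & H4). exists d'.
        intros y0 Hy0 E0. exists y'. repeat (split; auto). intros i Hi. rewrite (H3 i Hi).
        rewrite <- Ey in E0. symmetry. exact (ext_in_map E0 i Hi).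
      - exists d. intros y Hy Ey. destruct N. eauto. }
    destruct (small_range_bounded HK
      (fun v => proj1_sig (constructive_indefinite_description _ (Hf v)))
      (small_list HK (small_valid d))) as [u Hu].
    exists u. intros y Hy.
    assert (Hv : Forall (fun x => valid d x) (map y l)).
    { apply Forall_map, Forall_forall. exact Hy. }
    specialize (Hu (exist _ _ Hv)).
    destruct constructive_indefinite_description as [d' Hd']; simpl in *.
    destruct (Hd' y Hy eq_refl) as (y' & H1 & H2 & H3 & H4).
    exists d', y'. auto. }
  exists (fun d => proj1_sig (constructive_indefinite_description _ (H d))).
  intros d y Hy. destruct constructive_indefinite_description; simpl. auto.
Qed.

Definition tag (ls : I -> list K) (d : K) (y : I -> list K) : K * list (J * list K * list K) :=
  (d, map (fun i => (rep d (iota i), y i, ls i)) l).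

(** The set to be guessed: the members of [D] labelled by the path names [ls]. Levels above [s] are
    required so that the branches are already separated there. *)
Definition target (s : K) (ls : I -> list K) (z : K * list (J * list K * list K)) : Prop :=
  exists d y, z = tag ls d y /\ s < d /\ tuple d y /\ tuple d ls /\ D d y.

Lemma tag_normal ls d y : tuple d y -> tuple d ls -> normal (tag ls d y).
Proof.
  intros Hy Hls. unfold normal; simpl. apply Forall_map, Forall_forall.
  intros i Hi; simpl. split; [apply rep_idem|]. auto.
Qed.

Lemma tag_ext ls ls' d y y' : tag ls d y = tag ls' d y' ->
  forall i, In i l -> y i = y' i /\ ls i = ls' i.
Proof.
  intros E i Hi. injection E as E. pose proof (ext_in_map E i Hi) as E'.
  injection E' as E1 E2. auto.
Qed.

Lemma pre_next a b b' g : on_path (C a) g b -> b < b' ->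
  (forall x, C a x -> b < x -> b' <= x) -> pre (C a) b' g = b.
Proof.
  intros H1 H2 H3. unfold pre. set (p := epsilon _ _).
  assert (Hx : forall y, on_path (C a) g y -> y < b' -> y <= b).
  { intros y Hy Hyb. apply (nlt_le HK). intros H. destruct Hy as [->|[Hy _]].
    - destruct H1 as [->|[_ H1]]; [destruct (lt_irr HK H)|exact (lt_irr HK (lt_tr HK H H1))].
    - apply (lt_irr HK (lt_le_tr HK Hyb (H3 y Hy H))). }
  assert (Hp : on_path (C a) g p /\ p < b' /\ forall y, on_path (C a) g y -> y < b' -> y <= p).
  { apply epsilon_spec. exists b. auto. }
  destruct Hp as (Q1 & Q2 & Q3). apply (le_antisym HK); auto.
Qed.

(* If the guess at the successor [b'] of [b] in [C a] is correct, then the tuple of paths named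
   by [y] moves from [b] to [b'] through the set [D]. *)
Lemma seal_step a b b' s y g :
  (forall i i', In i l -> In i' l -> rep s (iota i) = rep s (iota i') -> i = i') ->
  (forall d y, tuple d y ->
    exists d' y', d < d' /\ d' < g d /\ tuple d' y' /\ above d y d' y' /\ D d' y') ->
  tuple a y -> C a b -> C a b' -> b < b' -> s < b ->
  (forall x, C a x -> b < x -> b' <= x) ->
  (forall i, In i l -> exists h t, y i = h :: t /\ h < b /\ valid h t) ->
  (forall c, c < b' -> g c < b') ->
  (forall c, c < b' -> exists d, c < d /\ d < b') ->
  (forall z, Guess b' z <-> target s y z /\ fst z < b') ->
  D a y.
Proof.
  intros Hsep Hg Hy Cb Cb' Hbb' Hsb Hnext Hhd Hclosed Hlim HG.
  assert (Ha : b' < a) by auto.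
  assert (Hba : b < a) by auto.
  assert (Hnacc : ~ acc lt (C a) b').
  { intros (_ & [_ Hs] & _). apply (lt_irr HK (lt_le_tr HK Hbb' (Hs b (fun x Hx =>
      proj1 (nlt_le HK) (fun H => lt_irr HK (lt_le_tr HK (proj2 Hx) (Hnext x (proj1 Hx) H))))))). }
  set (x i := proj a (iota i) (y i) b).
  assert (Hx : tuple b x) by (intros i Hi; apply proj_valid; auto).
  assert (Hpos : forall i, In i l -> exists h t, y i = h :: t /\ h < b /\
    valid h t /\ on_path (C a) h b /\ pre (C a) b' h = b /\
    pos (C a) b (iota i) (y i) = x i).
  { intros i Hi. destruct (Hhd i Hi) as (h & t & E & H1 & H2). exists h, t.
    assert (Hp : on_path (C a) h b) by (right; auto).
    repeat (split; auto).
    - apply pre_next; auto.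
    - unfold x. specialize (Hy i Hi). rewrite E in *. rewrite proj_pos; auto. }
  (* The positions at [b] extend into [D] at a level [d1] below [b'], because [b'] is closed under
     [g]; paths starting there then lead up to level [b']. *)
  destruct (Hg b x Hx) as (d1 & y1 & Hd1 & Hd1g & Hy1 & Hxy1 & HD1).
  assert (Hd1b : d1 < b') by (exact (lt_tr HK Hd1g (Hclosed b Hbb'))).
  set (y2 i := d1 :: y1 i).
  assert (Hy2 : tuple b' y2) by (intros i Hi; split; auto; apply Hy1; auto).
  assert (Hy21 : forall i, In i l -> proj b' (iota i) (y2 i) d1 = y1 i).
  { intros i Hi. apply proj_cons; auto. }
  set (w := map (fun i => (iota i, y2 i, y i)) l).
  set (P := proj_rec b') in *.
  set (good := sealed b' P (pre (C a) b') (prevpos (C a) b')).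
  assert (Hw : good w).
  { split.
    - intros j yy ll Hin. apply in_map_iff in Hin. destruct Hin as (i & E & Hi).
      injection E as <- <- <-.
      destruct (Hpos i Hi) as (h & t & E & H1 & H2 & H3 & H4 & H5).
      unfold extends. rewrite E at 1 2 4. simpl. rewrite H4. split; [split|].
      + apply Hy2; auto.
      + rewrite prevpos_lt, H5; auto. change (proj b' (iota i) (y2 i) b = x i).
        rewrite <- (@proj_proj b' _ _ d1); auto. rewrite Hy21; auto.
        rewrite <- (Hxy1 i Hi). rewrite projle_lt; auto.
      + exact (lt_tr HK H1 Hbb').
    - exists d1. split; auto. intros d Hd1d Hdb. apply HG. simpl. split; auto.
      assert (Hyd : tuple d (fun i => proj b' (iota i) (y2 i) d)).
      { intros i Hi. apply proj_valid; auto. }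
      exists d, (fun i => proj b' (iota i) (y2 i) d). repeat split; auto.
      + unfold tag, w. rewrite map_map. reflexivity.
      + exact (lt_tr HK Hsb (lt_le_tr HK Hd1 Hd1d)).
      + intros i Hi. destruct (Hhd i Hi) as (h & t & E & H1 & H2). rewrite E. split; auto.
        exact (lt_tr HK H1 (lt_le_tr HK Hd1 Hd1d)).
      + apply (D_open HD1 Hd1d Hyd). intros i Hi. destruct Hd1d as [Hd1d| ->].
        * rewrite projle_lt, proj_proj; auto.
        * rewrite projle_eq; auto. }
  (* The tuple [w] only shows that sealed tuples exist. The chosen tuple [v] may be another one, so
     its branches and path names are recovered from its guessed restrictions. *)
  set (v := epsilon (inhabits nil) good).
  assert (Hv : good v) by (apply epsilon_spec; eauto). fold v.
  destruct Hv as [Hv1 (d0 & Hd0 & Hv2)].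
  assert (Hv3 : forall d, d0 <= d -> d < b' -> exists yd, s < d /\ tuple d yd /\ D d yd /\
    map (restr b' P d) v = map (fun i => (rep d (iota i), yd i, y i)) l).
  { intros d H1 H2. specialize (Hv2 d H1 H2). apply HG in Hv2.
    destruct Hv2 as [(d' & yd & E & H3 & H4 & H5 & H6) _]. injection E as <- E.
    exists yd. auto. }
  (* The restriction at [d] matches each entry of [v] with some index. Agreement with [i] at [d0],
     which is above [s], forces this index to be [i]. *)
  assert (Hv4 : forall i j yy ll d, In i l -> d0 <= d -> d < b' -> In (j, yy, ll) v ->
    rep d0 j = rep d0 (iota i) -> rep d j = rep d (iota i)).
  { intros i j yy ll d Hi H1 H2 Hin E. destruct (Hv3 d H1 H2) as (yd & H3 & H4 & H5 & H6).
    assert (Hin' := in_map (restr b' P d) _ _ Hin). rewrite H6 in Hin'.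
    apply in_map_iff in Hin'. destruct Hin' as (i' & E' & Hi'). injection E' as E1 E2 E3.
    replace i with i'; auto. apply Hsep; auto.
    destruct (Hv3 d0) as (_ & Hs & _); [right; auto|auto|].
    apply (rep_eq_le (b := d0)); [left; auto|]. rewrite <- E.
    apply (rep_eq_le (b := d)); auto. }
  assert (Hhit : forall i, In i l ->
    hit b' P (pre (C a) b') (prevpos (C a) b') (iota i) (y i) (proj a (iota i) (y i) b')).
  { intros i Hi. destruct (Hpos i Hi) as (h & t & E & H1 & H2 & H3 & H4 & H5).
    assert (Hz : exists z, (valid b' z /\ proj b' (iota i) z b = pos (C a) b (iota i) (y i)) /\
      hit b' P (pre (C a) b') (prevpos (C a) b') (iota i) (y i) z).
    { destruct (Hv3 d0) as (yd & Q1 & Q2 & Q3 & Q4); [right; auto|auto|].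
      assert (Hin := in_map (fun i => (rep d0 (iota i), yd i, y i)) _ _ Hi).
      rewrite <- Q4 in Hin. apply in_map_iff in Hin.
      destruct Hin as ([[j z] ll] & E' & Hin). injection E' as E1 E2 E3. subst ll.
      (* The branches agree at all levels below [b'], and [b'] is a limit. *)
      assert (Ej : rep b' j = rep b' (iota i)).
      { apply rep_lim; auto. intros c Hc.
        destruct (lt_tot HK c d0) as [H|H].
        - apply (rep_eq_le (b := d0)); [left|]; auto.
        - apply (Hv4 i j z (y i) c Hi); auto. destruct H as [->|H]; [right|left]; auto. }
      destruct (Hv1 _ _ _ Hin) as [[V1 V2] _]. exists z. split.
      - split; auto. rewrite E in V2 at 1 2. simpl in V2. rewrite H4, prevpos_lt in V2; auto.
        rewrite <- (pos_rep (C a) (y i) (rep_eq_le (or_introl Hbb') Ej)), <- V2.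
        apply proj_rep. auto.
      - exists j. auto. }
    rewrite E in Hz |- *. apply pos_sealed; auto.
    - rewrite <- E. auto.
    - right. split; auto. exact (lt_tr HK H1 Hbb').
    - exact (lt_tr HK H1 Hbb').
    - rewrite H4. exact Hz. }
  (* The paths now pass through [v], so [y] projects at [d0] to the member [yd] of [D]; openness
     carries this up to level [a]. *)
  destruct (Hv3 d0) as (yd & Q1 & Q2 & Q3 & Q4); [right; auto|auto|].
  apply (D_open Q3 (or_introl (lt_tr HK Hd0 Ha)) Hy).
  intros i Hi. rewrite projle_lt; [|exact (lt_tr HK Hd0 Ha)].
  rewrite <- (@proj_proj a _ _ b'); auto.
  destruct (Hhit i Hi) as (j & Hin & Ej). fold good v in Hin.
  assert (Hin' := in_map (restr b' P d0) _ _ Hin). rewrite Q4 in Hin'.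
  apply in_map_iff in Hin'. destruct Hin' as (i' & E' & Hi'). injection E' as E1 E2 E3.
  assert (Ei : i' = i).
  { apply Hsep; auto. apply (rep_eq_le (b := d0)); [left; auto|]. rewrite E1.
    apply (rep_eq_le (b := b')); [left; auto|]. auto. }
  subst i'. rewrite E2. unfold proj. rewrite Ej. reflexivity.
Qed.

(** The sets [B i] predict [D] for the tuple of path names with code [i]. A tuple of level [a] has
    such a code below [a], so the proxy principle provides a step in [C a] where its own prediction
    is correct. *)
Lemma dense_open_level : exists a, forall y, tuple a y -> D a y.
Proof.
  destruct separation_level as [s Hsep].
  destruct density_bound as [g2 Hg2]. destruct code_bound as [g1 Hg1].
  assert (Hg : exists g : K -> K, forall d, g1 d <= g d /\ g2 d <= g d /\ d < g d).
  { assert (H : forall d, exists u, g1 d <= u /\ g2 d <= u /\ d < u).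
    { intros d. destruct (upper_bound2 HK (g1 d) (g2 d)) as (u & H1 & H2).
      destruct (no_max HK d) as [d' Hd'].
      destruct (upper_bound2 HK u d') as (u' & H3 & H4).
      exists u'. split; [exact (le_tr HK H1 H3)|]. split; [exact (le_tr HK H2 H3)|].
      exact (lt_le_tr HK Hd' H4). }
    exists (fun d => proj1_sig (constructive_indefinite_description _ (H d))).
    intros d. destruct constructive_indefinite_description; auto. }
  destruct Hg as [g Hg].
  assert (Hlim : forall b, (forall c, c < b -> g c < b) -> forall c, c < b -> exists d, c < d /\ d < b).
  { intros b Hb c Hc. exists (g c). split; auto. apply Hg. }
  set (good ls b := (forall c, c < b -> g c < b) /\
    forall z, Guess b z <-> target s ls z /\ fst z < b).
  set (coded i ls := exists m, tuple m ls /\ code (tag ls m ls) = i).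
  (* Ordinals that code no tuple of names receive the whole of [K], which keeps every [B i]
     unbounded. *)
  set (B i b := (exists ls, coded i ls /\ good ls b) \/ ~ exists ls, coded i ls).
  assert (HB : forall i, unbounded lt (B i)).
  { intros i a. destruct (classic (exists ls, coded i ls)) as [[ls Hls]|N].
    - destruct (@Guess_unbounded (target s ls) g a) with (a := a) as [b [[[H1 H2] H3] H4]].
      { intros z (d & y & -> & _ & H1 & H2 & _). apply tag_normal; auto. }
      exists b. split; auto. left. exists ls. split; auto. split; auto.
    - destruct (no_max HK a) as [b Hb]. exists b. split; auto. right; auto. }
  destruct (@C_guess B HB _ (club_closed HK g s)) as [a [[Hsa Hga] Ha]].
  exists a. intros y Hy.
  (* A name depends on its level only through the bound on its head, so the finitely many names
     [y i] are already names of one level [m] below [a]. *)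
  assert (Hm : forall l', (forall i, In i l' -> In i l) -> exists m, s <= m /\ m < a /\
    forall i, In i l' -> exists h t, y i = h :: t /\ h < m /\ valid h t).
  { induction l' as [|i l' IH]; intros Hl'.
    - exists s. split; [right; auto|]. split; auto. intros i [].
    - destruct IH as (m & H1 & H2 & H3); [intros; apply Hl'; right; auto|].
      specialize (Hy i (Hl' i (or_introl eq_refl))).
      destruct (y i) as [|h t] eqn:Eyi; [destruct (Hy s Hsa)|]. destruct Hy as [Hy1 Hy2].
      assert (Hmm : exists m', m <= m' /\ h < m' /\ m' < a).
      { destruct (classic (h < m)); [exists m; split; auto; right; auto|].
        destruct (Hlim a Hga h Hy1) as (m' & H4 & H5). exists m'. split; auto. left.
        apply (le_lt_tr HK (b := h)); auto. apply (nlt_le HK); auto. }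
      destruct Hmm as (m' & H4 & H5 & H6). exists m'.
      split; [exact (le_tr HK H1 H4)|]. split; auto.
      intros i' [<-|Hi']; [exists h, t; auto|].
      destruct (H3 i' Hi') as (h' & t' & E & H7 & H8). exists h', t'. split; auto. split; auto.
      exact (lt_le_tr HK H7 H4). }
  destruct (Hm l) as (m & Hsm & Hma & Hhd); [auto|].
  assert (Hym : tuple m y).
  { intros i Hi. destruct (Hhd i Hi) as (h & t & -> & H1 & H2). split; auto. }
  set (i0 := code (tag y m y)).
  assert (Hi0 : i0 < a).
  { apply (lt_tr HK (b := g1 m)).
    - apply (Hg1 (tag y m y)), tag_normal; auto.
    - apply (le_lt_tr HK (b := g m)); auto. apply Hg. }
  destruct (Ha i0 Hi0 1%nat) as [_ Hsup].
  assert (Hb : exists b, (C a b /\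
    forall d, suc lt 1 (fun x => C a x /\ b <= x) d -> B i0 d) /\ m < b).
  { apply NNPP. intros N. apply (lt_irr HK (lt_le_tr HK Hma (Hsup m (fun b Hb =>
      proj1 (nlt_le HK) (fun H => N (ex_intro _ b (conj Hb H))))))). }
  destruct Hb as [b [[Cb Hb] Hmb]].
  destruct (wf_least (fun x => C a x /\ b < x) (lt_wf HK)) as [b' [[Cb' Hbb'] Hmin]].
  { destruct (Hlim a Hga b (C_lt Cb)) as (d & H1 & H2).
    destruct (C_cof H2) as (c & H3 & H4); [eauto|]. exists c. split; auto.
    exact (lt_le_tr HK H1 H4). }
  assert (Hnext : forall x, C a x -> b < x -> b' <= x).
  { intros x H1 H2. apply (nlt_le HK). intros H3. apply (Hmin x); auto. }
  assert (Hbelow : forall x, (C a x /\ b <= x) /\ x < b' -> x = b).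
  { intros x [[H1 [H2|H2]] H3]; auto.
    destruct (lt_irr HK (lt_le_tr HK H3 (Hnext x H1 H2))). }
  (* With [n = 1], the successor set of the part of [C a] from [b] on contains [b'], the only
     predecessor being [b]. *)
  assert (HBb : B i0 b').
  { apply Hb. split; [split|].
    - split; auto. left; auto.
    - intros (_ & [_ Hs] & _). apply (lt_irr HK (lt_le_tr HK Hbb' (Hs b (fun x Hx =>
        or_intror (Hbelow x Hx))))).
    - exists (b :: nil). split; [constructor; [intros []|constructor]|].
      split; [simpl; auto|]. intros x. split.
      + intros [<-|[]]. split; auto. split; auto. right; auto.
      + intros Hx. left. symmetry. auto. }
  destruct HBb as [(ls & (m' & Hls & Ecode) & Hgood1 & Hgood2)|N].
  2:{ destruct N. exists y, m. auto. }
  assert (Etag : tag ls m' ls = tag y m y).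
  { apply code_inj; auto; apply tag_normal; auto. }
  (* The good [b'] was obtained for some tuple with code [i0]; injectivity of the code identifies it
     with [y] on [l]. *)
  assert (Els : forall i, In i l -> ls i = y i).
  { assert (Em : m' = m) by exact (f_equal fst Etag). subst m'.
    intros i Hi. apply (tag_ext Etag i Hi). }
  assert (Etarget : forall z, target s ls z <-> target s y z).
  { intros z. unfold target, tuple. split; intros (d & yd & E & H1 & H2 & H3 & H4);
      exists d, yd; (split; [rewrite E; unfold tag; f_equal; apply map_ext_in;
        intros i Hi; rewrite (Els i Hi); reflexivity|]);
      repeat (split; auto); intros i Hi; [rewrite <- Els|rewrite Els]; auto. }
  apply (@seal_step a b b' s y g); auto.
  - intros d yd Hd. destruct (Hg2 d yd Hd) as (d' & y' & H1 & H2 & H3). exists d', y'.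
    split; auto. split; auto. exact (lt_le_tr HK H2 (proj1 (proj2 (Hg d)))).
  - exact (le_lt_tr HK Hsm Hmb).
  - intros i Hi. destruct (Hhd i Hi) as (h & t & E & H1 & H2). exists h, t.
    split; auto. split; auto. exact (lt_tr HK H1 Hmb).
  - intros z. rewrite Hgood2, Etarget. reflexivity.
Qed.

End Sealing.
Hypothesis rep_small : forall a, small K {j | rep a j = j}.

(** * Souslin trees *)

Section Presented.
Variables (I : Type) (iota : I -> J) (l : list I).
(** An abstract tree whose nodes correspond to tuples of names indexed by [l]. One argument thereby
    covers the single trees and their finite products. *)
Variables (Q : Type) (R : Q -> Q -> Prop) (lev : Q -> K) (nm : Q -> I -> list K).
Hypothesis iota_inj : forall i i', iota i = iota i' -> i = i'.
Hypothesis l_nonempty : l <> nil.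
Hypothesis nm_valid : forall q, tuple l (lev q) (nm q).
Hypothesis nm_onto : forall d y, tuple l d y ->
  exists q, lev q = d /\ forall i, In i l -> nm q i = y i.
Hypothesis nm_inj : forall q q', lev q = lev q' ->
  (forall i, In i l -> nm q i = nm q' i) -> q = q'.
Hypothesis R_iff : forall q q', R q q' <-> lev q < lev q' /\
  forall i, In i l -> proj (lev q') (iota i) (nm q' i) (lev q) = nm q i.

Lemma presented_lev q q' : R q q' -> lev q < lev q'.
Proof. intros H. apply R_iff, H. Qed.

Lemma presented_trans x y z : R x y -> R y z -> R x z.
Proof.
  rewrite !R_iff. intros [H1 H2] [H3 H4]. split; [exact (lt_tr HK H1 H3)|].
  intros i Hi. rewrite <- (@proj_proj (lev z) _ _ (lev y)), H4; auto. apply nm_valid; auto.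
Qed.

Lemma presented_restr y d : d < lev y -> exists x, R x y /\ lev x = d.
Proof.
  intros Hd. destruct (@nm_onto d (fun i => proj (lev y) (iota i) (nm y i) d)) as (x & <- & Hx).
  - intros i Hi. apply proj_valid; auto. apply nm_valid; auto.
  - exists x. split; auto. apply R_iff. split; auto. intros i Hi. symmetry. auto.
Qed.

Lemma presented_below x y z : R x z -> R y z -> lev x < lev y -> R x y.
Proof.
  rewrite !R_iff. intros [H1 H2] [H3 H4] H. split; auto.
  intros i Hi. rewrite <- H2, <- H4, proj_proj; auto. apply nm_valid; auto.
Qed.

Lemma presented_unique x y z : R x z -> R y z -> lev x = lev y -> x = y.
Proof.
  rewrite !R_iff. intros [H1 H2] [H3 H4] H. apply nm_inj; auto.
  intros i Hi. rewrite <- H2, <- H4, H; auto.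
Qed.

Lemma valid_exists a : exists y, valid a y.
Proof.
  induction a as [a IH] using (well_founded_induction (lt_wf HK)).
  destruct (classic (exists b, b < a)) as [[b Hb]|N].
  - destruct (IH b Hb) as [y Hy]. exists (b :: y). split; auto.
  - exists nil. intros b Hb. eauto.
Qed.

Lemma presented_nonempty a : exists q, lev q = a.
Proof.
  destruct (valid_exists a) as [y Hy].
  destruct (@nm_onto a (fun _ => y)) as (q & Hq & _); [intros i _; auto|eauto].
Qed.

Lemma presented_small a : small K {q | lev q = a}.
Proof.
  refine (small_inj _ (small_list HK (small_valid a))).
  apply (injects_rel (fun (q : {q | lev q = a}) (v : {v | Forall (fun y => valid a y) v}) =>
    map (nm (proj1_sig q)) l = proj1_sig v)).
  - intros [q <-]. unshelve eexists (exist _ (map (nm q) l) _); [|reflexivity].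
    apply Forall_map, Forall_forall. apply nm_valid.
  - intros [q Hq] [q' Hq'] v; simpl. intros E E'. apply sig_eq, nm_inj; simpl; [congruence|].
    rewrite <- E' in E. exact (ext_in_map E).
Qed.

Lemma presented_height x a : height lt R x a <-> lev x = a.
Proof.
  apply (leveled_height HK); eauto using presented_lev, presented_restr, presented_below.
Qed.

Lemma presented_up q a : lev q < a -> exists q', R q q' /\ lev q' = a.
Proof.
  intros Ha. destruct (@nm_onto a (fun i => lev q :: nm q i)) as (q' & <- & Hq').
  - intros i Hi. split; auto. apply nm_valid; auto.
  - exists q'. split; auto. apply R_iff. split; auto. intros i Hi.
    rewrite Hq', proj_cons; auto. apply nm_valid; auto.
Qed.

Lemma presented_dense_open (E : Q -> Prop) :
  (forall q, exists q', R q q' /\ E q') -> (forall q q', E q -> R q q' -> E q') ->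
  exists a, forall q, lev q = a -> E q.
Proof.
  intros H1 H2.
  destruct (@dense_open_level I iota l
    (fun d y => exists q, lev q = d /\ (forall i, In i l -> nm q i = y i) /\ E q)) as [a Ha]; auto.
  - intros d y Hy. destruct (nm_onto Hy) as (q & <- & Hq). destruct (H1 q) as (q' & H3 & H4).
    apply R_iff in H3. destruct H3 as [H3 H5].
    exists (lev q'), (nm q'). split; auto. split; [apply nm_valid|]. split; [|eauto].
    intros i Hi. rewrite projle_lt, <- Hq; auto.
  - intros d y d' y' (q & <- & Hq & Eq) Hd Hy' Hab.
    destruct (nm_onto Hy') as (q' & <- & Hq'). exists q'. split; auto. split; auto.
    destruct Hd as [Hd|Hd].
    + apply (H2 q); auto. apply R_iff. split; auto. intros i Hi.
      rewrite Hq, Hq', <- (Hab i Hi), projle_lt; auto.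
    + replace q' with q; auto. apply nm_inj; auto. intros i Hi.
      rewrite Hq, Hq', <- (Hab i Hi); auto. rewrite Hd, projle_eq; auto.
  - exists a. intros q <-. destruct (Ha (nm q)) as (q' & H3 & H4 & H5); [apply nm_valid|].
    rewrite (@nm_inj q q'); auto. symmetry; auto.
Qed.

(** The complement of a cofinal branch is open because branches are downward closed, and dense
    because nodes split. Some level would then avoid the branch. *)
Lemma presented_aronszajn : aronszajn lt R.
Proof.
  split.
  - apply (@leveled_kappa_tree K lt HK _ _ lev);
      eauto using presented_trans, presented_lev, presented_restr, presented_below,
        presented_unique, presented_nonempty, presented_small.
  - intros (B & HB1 & HB2 & HB3).
    assert (Bdown : forall q q', ~ B q -> R q q' -> ~ B q') by eauto.
    destruct (@presented_dense_open (fun q => ~ B q)) as [a Ha]; auto.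
    + intros q. destruct (no_max HK (lev q)) as [d1 Hd1]. destruct (no_max HK d1) as [d2 Hd2].
      assert (Hd : lev q < d2) by exact (lt_tr HK Hd1 Hd2).
      destruct (@presented_up q d2 Hd) as (q1 & Hq1 & Hl1).
      apply NNPP. intros N.
      assert (HBu : forall q', R q q' -> B q').
      { intros q' Hq'. apply NNPP. intros N'. apply N. eauto. }
      destruct (@presented_up q d1 Hd1) as (q2 & Hq2 & Hl2).
      (* Two nodes of level [d2] above [q]: the paths of one start in [q], those of the other in
         [q2] of level [d1]. Their names have different heads, so they cannot both lie on a
         branch. *)
      destruct (@nm_onto d2 (fun i => lev q :: nm q i)) as (u & Hu1 & Hu2).
      { intros i Hi. split; auto. apply nm_valid; auto. }
      destruct (@nm_onto d2 (fun i => lev q2 :: nm q2 i)) as (v & Hv1 & Hv2).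
      { intros i Hi. split; [congruence|]. apply nm_valid; auto. }
      assert (Ru : R q u).
      { apply R_iff. rewrite Hu1. split; auto. intros i Hi. rewrite Hu2, proj_cons; auto.
        apply nm_valid; auto. }
      assert (Rv : R q v).
      { apply (@presented_trans _ q2); auto. apply R_iff. rewrite Hv1, Hl2. split; auto.
        intros i Hi. rewrite Hv2, Hl2, proj_cons; auto. rewrite <- Hl2. apply nm_valid; auto. }
      destruct (HB1 u v) as [H|[H|H]]; auto.
      * apply presented_lev in H. rewrite Hu1, Hv1 in H. exact (lt_irr HK H).
      * destruct l as [|i l']; [auto|]. specialize (Hu2 i (or_introl eq_refl)).
        specialize (Hv2 i (or_introl eq_refl)). subst v. rewrite Hu2 in Hv2.
        injection Hv2 as Hv2 _. assert (Ed : lev q = d1) by congruence. rewrite Ed in Hd1.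
        exact (lt_irr HK Hd1).
      * apply presented_lev in H. rewrite Hu1, Hv1 in H. exact (lt_irr HK H).
    + destruct (HB3 a) as (x & Hx & Hxa). apply presented_height in Hxa.
      exact (Ha x Hxa Hx).
Qed.

(** Nodes at or above a member of the antichain, or incompatible with all members, form a dense open
    set. It contains a level [d], so no member lies beyond [d], and only fewer than kappa nodes
    remain. *)
Lemma presented_souslin : souslin lt R /\ forall x a, height lt R x a <-> lev x = a.
Proof.
  split; [|exact presented_height].
  split; [exact presented_aronszajn|]. intros (A & HA1 & HA2).
  assert (Hle : forall q, exists q', R q q').
  { intros q. destruct (no_max HK (lev q)) as [d Hd].
    destruct (presented_up Hd) as (q' & Hq' & _). eauto. }
  set (Rle q q' := R q q' \/ q = q').
  assert (Rle_tr : forall x y z, Rle x y -> R y z -> R x z).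
  { intros x y z [H| ->] H'; auto. exact (presented_trans H H'). }
  destruct (@presented_dense_open (fun q => (exists a, Rle (A a) q) \/
      forall a z, ~ (Rle q z /\ Rle (A a) z))) as [d Hd].
  - intros q. destruct (classic (exists a z, Rle q z /\ Rle (A a) z)) as [(a & z & H1 & H2)|N].
    + destruct (Hle z) as [z' Hz']. exists z'. split; [exact (Rle_tr _ _ _ H1 Hz')|].
      left. exists a. left. exact (Rle_tr _ _ _ H2 Hz').
    + destruct (Hle q) as [q' Hq']. exists q'. split; auto. right. intros a z [H1 H2].
      apply N. exists a, z. split; auto. left.
      destruct H1 as [H1|<-]; auto. exact (presented_trans Hq' H1).
  - intros q q' [[a Ha]|N] H.
    + left. exists a. left. exact (Rle_tr _ _ _ Ha H).
    + right. intros a z [H1 H2]. apply (N a z). split; auto. left.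
      destruct H1 as [H1|<-]; auto. exact (presented_trans H H1).
  - assert (HAd : forall a, ~ d < lev (A a)).
    { intros a Ha. destruct (presented_restr Ha) as (q & Hq & Eq).
      destruct (Hd q Eq) as [[b Hb]|N].
      - assert (H : R (A b) (A a)) by exact (Rle_tr _ _ _ Hb Hq).
        apply (HA2 b a); auto. intros ->. exact (lt_irr HK (presented_lev H)).
      - apply (N a (A a)). split; [left|right]; auto. }
    destruct (no_max HK d) as [d' Hd'].
    assert (Hs : small K {q | lev q < d'}).
    { apply (small_fibres HK (fun q : {q | lev q < d'} =>
        exist (fun b => b < d') (lev (proj1_sig q)) (proj2_sig q)) (small_seg HK d')).
      intros [b Hb]. refine (small_inj _ (@presented_small b)).
      apply (injects_rel (fun x (y : {q | lev q = b}) => proj1_sig (proj1_sig x) = proj1_sig y)).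
      - intros [x Hx]. exists (exist _ (proj1_sig x) (f_equal (@proj1_sig _ _) Hx)). reflexivity.
      - intros x x' y E E'. apply sig_eq, sig_eq. congruence. }
    apply Hs. exists (fun a => exist (fun q => lev q < d') (A a)
      (le_lt_tr HK (proj1 (nlt_le HK) (HAd a)) Hd')).
    intros a b E. apply HA1. exact (f_equal (@proj1_sig _ _) E).
Qed.

End Presented.

(* Two nodes with the same predecessors and different names are distinct, so limit levels are
   not Hausdorff. *)
Definition node : Type :=
  {p : K * list K * J | valid (fst (fst p)) (snd (fst p)) /\ rep (fst (fst p)) (snd p) = snd p}.
Definition lev (u : node) : K := fst (fst (proj1_sig u)).
Definition name (u : node) : list K := snd (fst (proj1_sig u)).
Definition br (u : node) : J := snd (proj1_sig u).
Definition nodeR (u v : node) : Prop :=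
  lev u < lev v /\ rep (lev u) (br v) = br u /\ proj (lev v) (br v) (name v) (lev u) = name u.
Definition along (j : J) (u : node) : Prop := br u = rep (lev u) j.

Lemma name_valid u : valid (lev u) (name u).
Proof. apply (proj2_sig u). Qed.

Lemma rep_br u : rep (lev u) (br u) = br u.
Proof. apply (proj2_sig u). Qed.

Lemma node_eq u v : lev u = lev v -> name u = name v -> br u = br v -> u = v.
Proof.
  unfold lev, name, br. destruct u as [[[a l] j] Hu], v as [[[a' l'] j'] Hv]; simpl.
  intros H1 H2 H3. apply sig_eq; simpl. congruence.
Qed.

Lemma node_exists a l j : valid a l -> exists u, lev u = a /\ name u = l /\ br u = rep a j.
Proof.
  intros Hl. unshelve eexists (exist _ (a, l, rep a j) _); [|auto].
  simpl. split; auto. apply rep_idem.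
Qed.

(** Levels are small because a node is given by a name and a representative. Projections depend on
    the branch only up to the level, which makes the relation transitive across different
    branches. *)
Lemma node_kappa_tree : inhabited J -> kappa_tree lt nodeR /\
  forall u a, height lt nodeR u a <-> lev u = a.
Proof.
  intros [j0].
  assert (Hlev : forall x y, nodeR x y -> lev x < lev y) by (intros x y H; apply H).
  assert (Hrestr : forall y d, d < lev y -> exists x, nodeR x y /\ lev x = d).
  { intros y d Hd.
    destruct (@node_exists d (proj (lev y) (br y) (name y) d) (br y)) as (x & <- & H1 & H2).
    - apply proj_valid; auto. apply name_valid.
    - exists x. split; auto. repeat split; auto. }
  assert (Hproj : forall x y d, nodeR x y -> d < lev x ->
    proj (lev x) (br x) (name x) d = proj (lev y) (br y) (name y) d).
  { intros x y d (H1 & H2 & H3) Hd. rewrite <- H3.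
    rewrite (@proj_rep (lev x) (br x) (br y)), proj_proj; auto using name_valid.
    rewrite H2. apply rep_br. }
  assert (Hbelow : forall x y z, nodeR x z -> nodeR y z -> lev x < lev y -> nodeR x y).
  { intros x y z Hx Hy Hxy. pose proof (Hproj y z (lev x) Hy Hxy) as E.
    destruct Hx as (H1 & H2 & H3), Hy as (H4 & H5 & H6).
    split; auto. split; [|congruence].
    rewrite <- H5, rep_le; auto. left; auto. }
  assert (Htr : forall x y z, nodeR x y -> nodeR y z -> nodeR x z).
  { intros x y z Hx Hy. pose proof (Hproj y z (lev x) Hy (Hlev _ _ Hx)) as E.
    destruct Hx as (H1 & H2 & H3), Hy as (H4 & H5 & H6).
    split; [exact (lt_tr HK H1 H4)|]. split; [|congruence].
    rewrite <- (rep_le (b := lev y)), H5; auto. left; auto. }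
  assert (Huni : forall x y z, nodeR x z -> nodeR y z -> lev x = lev y -> x = y).
  { intros x y z (H1 & H2 & H3) (H4 & H5 & H6) E. apply node_eq; congruence. }
  split; [|intros; apply (leveled_height HK); auto; intros; eapply Hbelow; eauto].
  apply (@leveled_kappa_tree K lt HK _ _ lev); auto.
  - intros a. destruct (valid_exists a) as [y Hy].
    destruct (@node_exists a y j0 Hy) as (x & Hx & _). eauto.
  - intros a. refine (small_inj _ (small_prod HK (small_valid a) (@rep_small a))).
    apply (injects_rel (fun (u : {u | lev u = a}) (v : {l | valid a l} * {j | rep a j = j}) =>
      name (proj1_sig u) = proj1_sig (fst v) /\ br (proj1_sig u) = proj1_sig (snd v))).
    + intros [u <-]. exists (exist _ _ (name_valid u), exist (fun j => rep (lev u) j = j) _ (rep_br u)). auto.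
    + intros [u Hu] [u' Hu'] v [H1 H2] [H3 H4]; simpl in *. apply sig_eq, node_eq; simpl; congruence.
Qed.

(** The case of a single coordinate: within [along j], projecting with the stored representative or
    with [j] gives the same result. *)
Lemma along_souslin j : souslin lt (sub_rel nodeR (along j)) /\
  forall u a, height lt (sub_rel nodeR (along j)) u a <-> lev (proj1_sig u) = a.
Proof.
  apply (@presented_souslin J (fun j => j) (j :: nil) _ _
    (fun u => lev (proj1_sig u)) (fun u _ => name (proj1_sig u))); auto; try discriminate.
  - intros u i _. apply name_valid.
  - intros d y Hy. destruct (@node_exists d (y j) j) as (u & H1 & H2 & H3); [apply Hy; left; auto|].
    assert (Hu : along j u) by (unfold along; congruence).
    exists (exist _ u Hu). split; auto. intros i [<-|[]]. auto.
  - intros u v E Hn. apply sig_eq, node_eq; auto.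
    + apply (Hn j). left; auto.
    + rewrite (proj2_sig u), (proj2_sig v). congruence.
  - intros [u Hu] [v Hv]; unfold sub_rel, nodeR; simpl. unfold along in Hu, Hv.
    assert (E : forall d, proj (lev v) (br v) (name v) d = proj (lev v) j (name v) d).
    { intros d. apply proj_rep. rewrite rep_br. auto. }
    split.
    + intros (H1 & H2 & H3). split; auto. intros i [<-|[]]. rewrite <- E. auto.
    + intros [H1 H2]. split; auto. split.
      * rewrite Hv, Hu, rep_le; auto. left; auto.
      * rewrite E. apply H2. left; auto.
Qed.

(** The representatives along a cofinal branch cohere and so come from one [j]. The branch then lies
    in [along j], which is Souslin. *)
Lemma node_aronszajn : inhabited J ->
  (forall f : K -> J, (forall a b, a < b -> rep a (f b) = f a) -> exists j, forall a, rep a j = f a) ->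
  aronszajn lt nodeR.
Proof.
  intros HJ Hcomplete. destruct (node_kappa_tree HJ) as [Htree Hheight].
  split; auto. intros (B & HB1 & HB2 & HB3).
  assert (Hx : forall a, exists u, B u /\ lev u = a).
  { intros a. destruct (HB3 a) as (u & Hu & Ha). exists u. split; auto. apply Hheight; auto. }
  set (x a := proj1_sig (constructive_indefinite_description _ (Hx a))).
  assert (Bx : forall a, B (x a) /\ lev (x a) = a).
  { intros a. unfold x. destruct constructive_indefinite_description; auto. }
  clearbody x.
  assert (Hlt : forall u v, B u -> B v -> lev u < lev v -> nodeR u v).
  { intros u v Hu Hv H. destruct (HB1 u v Hu Hv) as [H'|[->|(H' & _)]]; auto.
    - destruct (lt_irr HK H).
    - destruct (lt_irr HK (lt_tr HK H H')). }
  assert (Huni : forall u, B u -> u = x (lev u)).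
  { intros u Hu. destruct (Bx (lev u)) as [H1 H2].
    destruct (HB1 u (x (lev u)) Hu H1) as [(H & _)|[H|(H & _)]]; auto;
      rewrite H2 in H; destruct (lt_irr HK H). }
  destruct (Hcomplete (fun a => br (x a))) as [j Hj].
  { intros a b Hab. destruct (Bx a) as [Ha1 Ha2], (Bx b) as [Hb1 Hb2].
    destruct (Hlt (x a) (x b)) as (_ & H & _); auto; [congruence|]. rewrite Ha2 in H. exact H. }
  assert (HBj : forall u, B u -> along j u).
  { intros u Hu. unfold along. rewrite Hj. rewrite <- Huni; auto. }
  destruct (along_souslin j) as [[[_ Hno] _] Hsub]. apply Hno.
  exists (fun u => B (proj1_sig u)). split; [|split].
  - intros [u Hu] [v Hv] H1 H2; simpl in *. destruct (HB1 u v H1 H2) as [H|[H|H]]; auto.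
    right; left. apply sig_eq; auto.
  - intros [u Hu] [v Hv]; unfold sub_rel; simpl. eauto.
  - intros a. destruct (Bx a) as [Ha1 Ha2]. exists (exist _ (x a) (HBj _ Ha1)). split; auto.
    apply Hsub. exact Ha2.
Qed.

Lemma prod_souslin (I : Type) (iota : I -> J) (l : list I) :
  inhabited J -> (forall i i', iota i = iota i' -> i = i') -> l <> nil ->
  souslin lt (@prod_rel K lt node nodeR I (fun i => along (iota i)) (fun i => In i l)).
Proof.
  intros HJ iota_inj Hl. destruct (node_kappa_tree HJ) as [_ Hheight].
  assert (H0 : exists i, In i l) by (destruct l as [|i l']; [tauto|exists i; left; auto]).
  destruct H0 as [i0 Hi0].
  set (Q := @prod_type K lt node nodeR I (fun i => along (iota i)) (fun i => In i l)).
  set (k0 := exist (fun i => In i l) i0 Hi0).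
  set (qlev (q : Q) := lev (proj1_sig q k0)).
  assert (Hlev : forall (q : Q) k, lev (proj1_sig q k) = qlev q).
  { intros [q (Hq & a & Ha)] k. unfold qlev; simpl.
    transitivity a; [|symmetry]; apply Hheight; auto. }
  assert (Hbr : forall (q : Q) k, br (proj1_sig q k) = rep (qlev q) (iota (proj1_sig k))).
  { intros q k. rewrite <- (Hlev q k). apply (proj1 (proj2_sig q)). }
  (* Names must be given for every index; outside [l] the value [nil] is a mere default. *)
  set (nm (q : Q) i := match excluded_middle_informative (In i l) with
    | left h => name (proj1_sig q (exist _ i h)) | right _ => nil end).
  assert (Hnm : forall q k, nm q (proj1_sig k) = name (proj1_sig q k)).
  { intros q [i Hi]; unfold nm; simpl. destruct excluded_middle_informative; [|tauto].
    do 3 f_equal. apply proof_irrelevance. }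
  clearbody nm.
  assert (Hnm' : forall q i (Hi : In i l), nm q i = name (proj1_sig q (exist _ i Hi))).
  { intros q i Hi. rewrite <- Hnm. reflexivity. }
  apply (@presented_souslin I iota l Q _ qlev nm); auto.
  - intros q i Hi. rewrite (Hnm' q i Hi), <- (Hlev q (exist _ i Hi)). apply name_valid.
  - intros d y Hy.
    assert (Hf : forall k : {i | In i l}, exists u, lev u = d /\ name u = y (proj1_sig k) /\
      br u = rep d (iota (proj1_sig k))).
    { intros [i Hi]; simpl. apply node_exists; auto. }
    set (f k := proj1_sig (constructive_indefinite_description _ (Hf k))).
    assert (Ef : forall k, lev (f k) = d /\ name (f k) = y (proj1_sig k) /\
      br (f k) = rep d (iota (proj1_sig k))).
    { intros k. unfold f. destruct constructive_indefinite_description; auto. }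
    clearbody f. unshelve eexists (exist _ f _ : Q).
    + split.
      * intros k. destruct (Ef k) as (H1 & H2 & H3). unfold along. congruence.
      * exists d. intros k. apply Hheight, Ef.
    + split; [apply (Ef k0)|]. intros i Hi. rewrite (Hnm' _ i Hi). apply (Ef (exist _ i Hi)).
  - intros q q' E En. apply sig_eq. extensionality k. apply node_eq.
    + rewrite !Hlev. auto.
    + rewrite <- !Hnm. apply En. exact (proj2_sig k).
    + rewrite !Hbr, E. auto.
  - intros q q'. unfold prod_rel, nodeR.
    assert (E : forall k d, proj (qlev q') (br (proj1_sig q' k)) (name (proj1_sig q' k)) d =
      proj (qlev q') (iota (proj1_sig k)) (nm q' (proj1_sig k)) d).
    { intros k d. rewrite Hnm. apply proj_rep. rewrite Hbr. apply rep_idem. }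
    split.
    + intros H. split; [apply (H k0)|]. intros i Hi. destruct (H (exist _ i Hi)) as (_ & _ & H').
      rewrite !Hlev, E in H'. simpl in H'. rewrite H', <- Hnm'. auto.
    + intros [H1 H2] k. rewrite !Hlev, E, !Hbr. split; auto. split.
      * apply rep_le. left; auto.
      * rewrite H2, Hnm; auto. exact (proj2_sig k).
Qed.

Lemma along_subtree j : subtree nodeR (along j).
Proof.
  intros u v Hv (H1 & H2 & _). unfold along in *. rewrite <- H2, Hv, rep_le; auto. left; auto.
Qed.

Lemma along_inj j j' : (forall u, along j u <-> along j' u) -> j = j'.
Proof.
  intros H. apply rep_sep. intros a. destruct (valid_exists a) as [y Hy].
  destruct (@node_exists a y j Hy) as (u & H1 & H2 & H3).
  assert (Hu : along j u) by (unfold along; congruence).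
  apply H in Hu. unfold along in Hu. congruence.
Qed.

End Construction.

(** * Branches of the Kurepa tree and coding *)

Section Branches.
Variables (K : Type) (lt : K -> K -> Prop).
Hypothesis HK : regular_uncountable_cardinal lt.
Variables (X : Type) (R : X -> X -> Prop).
Hypothesis HX : kappa_tree lt R.

Notation "a < b" := (lt a b).
Notation "a <= b" := (le lt a b).

(** The isomorphism witnessing the height of [y] restricts to the predecessors of [x], with image
    the ordinals below the value at [x]. *)
Lemma height_lt x y a b : R x y -> height lt R x a -> height lt R y b -> a < b.
Proof.
  intros Hxy Ha (f & Hf1 & Hf2). destruct HX as ((_ & Rtr & _) & _).
  set (c := proj1_sig (f (exist _ x Hxy))).
  assert (Hc : c < b) by exact (proj2_sig (f (exist _ x Hxy))).
  replace a with c; auto. refine (height_unique HK (x := x) (R := R) _ Ha).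
  assert (Hlt : forall u : {z | R z x}, proj1_sig (f (exist _ (proj1_sig u) (Rtr _ _ _ (proj2_sig u) Hxy))) < c).
  { intros [u Hu]. apply Hf1. exact Hu. }
  exists (fun u => exist (fun d => d < c) _ (Hlt u)). split.
  - intros u v; simpl. rewrite <- Hf1. reflexivity.
  - intros [d Hd]. destruct (Hf2 (exist _ d (lt_tr HK Hd Hc))) as [[z Hz] Ez].
    assert (Hzx : R z x).
    { change (R (proj1_sig (exist (fun z => R z y) z Hz)) (proj1_sig (exist (fun z => R z y) x Hxy))).
      apply Hf1. rewrite Ez. exact Hd. }
    exists (exist _ z Hzx). apply sig_eq; simpl.
    replace (Rtr _ _ _ Hzx Hxy) with Hz by apply proof_irrelevance. rewrite Ez. reflexivity.
Qed.

Definition branch : Type := {B : X -> Prop | cofinal_branch lt R B}.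

Definition agree (a : K) (j j' : branch) : Prop :=
  forall x b, height lt R x b -> b < a -> (proj1_sig j x <-> proj1_sig j' x).

(** A choice from the agreement class of [j]. Equal classes give the same choice, so equality of
    representatives expresses agreement below [a]. *)
Definition repr (a : K) (j : branch) : branch := epsilon (inhabits j) (agree a j).

Lemma agree_repr a j : agree a j (repr a j).
Proof. unfold repr. apply epsilon_spec. exists j. intros x b _ _. reflexivity. Qed.

Lemma repr_eq a j j' : repr a j = repr a j' <-> agree a j j'.
Proof.
  split.
  - intros E x b Hx Hb. rewrite (agree_repr j Hx Hb), (agree_repr j' Hx Hb), E. reflexivity.
  - intros H. unfold repr.
    replace (inhabits j) with (inhabits j') by apply proof_irrelevance. f_equal.
    extensionality k. apply propositional_extensionality.
    split; intros H' x b Hx Hb; specialize (H x b Hx Hb); specialize (H' x b Hx Hb); tauto.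
Qed.

Lemma repr_le a b j : a <= b -> repr a (repr b j) = repr a j.
Proof.
  intros Hab. apply repr_eq. intros x c Hx Hc. symmetry.
  apply (@agree_repr b j x c Hx). exact (lt_le_tr HK Hc Hab).
Qed.

Lemma repr_lim a j j' : (forall b, b < a -> exists c, b < c /\ c < a) ->
  (forall b, b < a -> repr b j = repr b j') -> repr a j = repr a j'.
Proof.
  intros H1 H2. apply repr_eq. intros x b Hx Hb. destruct (H1 b Hb) as (c & Hc1 & Hc2).
  apply (proj1 (repr_eq c j j') (H2 c Hc2) x b Hx Hc1).
Qed.

Lemma repr_sep j j' : (forall a, repr a j = repr a j') -> j = j'.
Proof.
  intros H. apply sig_eq. extensionality x. apply propositional_extensionality.
  destruct HX as (_ & Hh & _). destruct (Hh x) as [b Hb]. destruct (no_max HK b) as [a Ha].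
  exact (proj1 (repr_eq a j j') (H a) x b Hb Ha).
Qed.

Lemma agree_below j j' x a : proj1_sig j x -> proj1_sig j' x -> height lt R x a -> agree a j j'.
Proof.
  assert (H : forall j j' : branch, proj1_sig j x -> proj1_sig j' x -> height lt R x a ->
    forall y b, height lt R y b -> b < a -> proj1_sig j y -> proj1_sig j' y).
  { clear j j'. intros [B (B1 & B2 & B3)] [B' (B1' & B2' & B3')]; simpl.
    intros Hx Hx' Ha y b Hb Hba Hy. destruct (B1 y x Hy Hx) as [H|[->|H]]; [eauto| |].
    - rewrite (height_unique HK Hb Ha) in Hba. destruct (lt_irr HK Hba).
    - destruct (lt_irr HK (lt_tr HK (height_lt H Ha Hb) Hba)). }
  intros H1 H2 H3 y b Hy Hb. split; eauto.
Qed.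

Lemma repr_small a : small K {j | repr a j = j}.
Proof.
  destruct HX as (_ & _ & _ & Hs). refine (small_inj _ (Hs a)).
  apply (injects_rel (fun (j : {j | repr a j = j}) (x : {x | height lt R x a}) =>
    proj1_sig (proj1_sig j) (proj1_sig x))).
  - intros [[B HB] Hj]; simpl. destruct HB as (B1 & B2 & B3). destruct (B3 a) as (x & Hx & Ha).
    exists (exist _ x Ha). exact Hx.
  - intros [j Hj] [j' Hj'] [x Hx]; simpl. intros H H'. apply sig_eq; simpl.
    rewrite <- Hj, <- Hj'. apply repr_eq. exact (@agree_below j j' x a H H' Hx).
Qed.

(** The required branch is the union of the parts of [f a] below [a], which cohere. *)
Lemma repr_complete (f : K -> branch) : (forall a b, a < b -> repr a (f b) = f a) ->
  exists j, forall a, repr a j = f a.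
Proof.
  intros Hf.
  assert (Hff : forall a b, a <= b -> agree a (f a) (f b)).
  { intros a b [Hab| ->].
    - apply repr_eq. rewrite <- (Hf a b Hab). apply repr_le. right; auto.
    - intros x c _ _. reflexivity. }
  destruct HX as ((_ & Rtr & _) & Hh & _).
  set (B x := exists b a, height lt R x b /\ b < a /\ proj1_sig (f a) x).
  assert (HB : forall x b a, height lt R x b -> b < a -> (B x <-> proj1_sig (f a) x)).
  { intros x b a Hx Hba. split; [|intros H; exists b, a; auto].
    intros (b' & a' & Hx' & Hba' & H). rewrite (height_unique HK Hx' Hx) in Hba'.
    destruct (upper_bound2 HK a a') as (c & Hc & Hc').
    apply (Hff a c Hc x b Hx Hba). apply (Hff a' c Hc' x b Hx Hba'). exact H. }
  assert (HBr : cofinal_branch lt R B).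
  { split; [|split].
    - intros x y Hx Hy. destruct (Hh x) as [b Hb], (Hh y) as [b' Hb'].
      destruct (upper_bound2 HK b b') as (c & Hc & Hc'). destruct (no_max HK c) as [a Ha].
      apply (proj1 (proj2_sig (f a))).
      + apply (HB x b a); auto. exact (le_lt_tr HK Hc Ha).
      + apply (HB y b' a); auto. exact (le_lt_tr HK Hc' Ha).
    - intros x y (b & a & Hb & Hba & Hy) Hxy. destruct (Hh x) as [c Hc].
      exists c, a. split; auto. split; [exact (lt_tr HK (height_lt Hxy Hc Hb) Hba)|].
      exact (proj1 (proj2 (proj2_sig (f a))) x y Hy Hxy).
    - intros a. destruct (no_max HK a) as [a' Ha'].
      destruct (proj2 (proj2 (proj2_sig (f a'))) a) as (x & Hx & Hxa).
      exists x. split; auto. exists a, a'. auto. }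
  exists (exist _ B HBr). intros a. destruct (no_max HK a) as [b Hb].
  rewrite <- (Hf a b Hb). apply repr_eq. intros x c Hx Hc; simpl.
  apply (HB x c b Hx). exact (lt_tr HK Hc Hb).
Qed.

End Branches.

(** * Coding tuples by ordinals and decoding the diamond *)

Section Coding.
Variables (K : Type) (lt : K -> K -> Prop).
Hypothesis HK : regular_uncountable_cardinal lt.
Variables (J : Type) (rep : K -> J -> J).
Hypothesis rep_small : forall a, small K {j | rep a j = j}.

Notation "a < b" := (lt a b).
Notation "a <= b" := (le lt a b).

Lemma normal_fibre_small a : small K {z | normal lt rep z /\ fst z = a}.
Proof.
  set (E e := rep a (fst (fst e)) = fst (fst e) /\ valid lt a (snd (fst e)) /\ valid lt a (snd e)).
  assert (HE : small K {e | E e}).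
  { refine (small_inj _ (small_prod HK (small_prod HK (@rep_small a) (small_valid HK a)) (small_valid HK a))).
    exists (fun e : {e | E e} => (exist (fun j => rep a j = j) _ (proj1 (proj2_sig e)),
      exist (valid lt a) _ (proj1 (proj2 (proj2_sig e))),
      exist (valid lt a) _ (proj2 (proj2 (proj2_sig e))))).
    intros [[[j y] t] He] [[[j' y'] t'] He'] E'. apply sig_eq. simpl in *. congruence. }
  refine (small_inj _ (small_list HK HE)).
  apply (injects_rel (fun (z : {z | normal lt rep z /\ fst z = a}) (v : {v | Forall E v}) =>
    snd (proj1_sig z) = proj1_sig v)).
  - intros [[b v] [Hz Eb]]; simpl in Eb; subst b. exists (exist _ v Hz). reflexivity.
  - intros [[b v] [Hz Eb]] [[b' v'] [Hz' Eb']] u; simpl in *. intros H H'. apply sig_eq; simpl.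
    congruence.
Qed.

Lemma coding_exists : exists code : K * list (J * list K * list K) -> K,
  (forall z z', normal lt rep z -> normal lt rep z' -> code z = code z' -> z = z') /\
  exists g : K -> K, forall z, normal lt rep z -> code z < g (fst z).
Proof.
  destruct (small_rank_injects HK (fun z : {z | normal lt rep z} => fst (proj1_sig z))) as [c Hc].
  { intros a. refine (small_inj _ (normal_fibre_small (a := a))).
    exists (fun w : {z : {z | normal lt rep z} | fst (proj1_sig z) = a} =>
      exist (fun z => normal lt rep z /\ fst z = a) (proj1_sig (proj1_sig w))
        (conj (proj2_sig (proj1_sig w)) (proj2_sig w))).
    intros u v E. apply sig_eq, sig_eq. exact (f_equal (@proj1_sig _ _) E). }
  (* The value on tuples that are not normal is a default; both claims concern normal ones only. *)
  set (code z := match excluded_middle_informative (normal lt rep z) with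
    | left h => c (exist _ z h) | right _ => fst z end).
  assert (Hcode : forall z h, code z = c (exist _ z h)).
  { intros z h. unfold code. destruct excluded_middle_informative; [|tauto].
    do 2 f_equal. apply proof_irrelevance. }
  exists code. split.
  - intros z z' h h'. rewrite (Hcode z h), (Hcode z' h'). intros E. apply Hc in E.
    exact (f_equal (@proj1_sig _ _) E).
  - assert (H : forall a, exists u, forall z, normal lt rep z -> fst z = a -> code z < u).
    { intros a. destruct (small_range_bounded HK
        (fun w : {z | normal lt rep z /\ fst z = a} => code (proj1_sig w)) (normal_fibre_small (a := a)))
        as [u Hu].
      exists u. intros z H1 H2. exact (Hu (exist _ z (conj H1 H2))). }
    exists (fun a => proj1_sig (constructive_indefinite_description _ (H a))).
    intros z Hz. destruct constructive_indefinite_description as [u Hu]; simpl. auto.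
Qed.

(** The diamond guesses the set of codes of [Z]. At a level closed under the bound for codes, every
    tuple of smaller level has its code below, so the guess determines the part of [Z] below. *)
Lemma guess_exists : diamond lt ->
  exists (code : K * list (J * list K * list K) -> K)
    (Guess : K -> K * list (J * list K * list K) -> Prop),
  (forall z z', normal lt rep z -> normal lt rep z' -> code z = code z' -> z = z') /\
  (exists g : K -> K, forall z, normal lt rep z -> code z < g (fst z)) /\
  forall (Z : K * list (J * list K * list K) -> Prop) (g : K -> K) a,
    (forall z, Z z -> normal lt rep z) ->
    unbounded lt (fun b => (a < b /\ forall c, c < b -> g c < b) /\
      forall z, Guess b z <-> Z z /\ fst z < b).
Proof.
  intros (A & _ & HA). destruct coding_exists as (code & Hinj & g1 & Hg1).
  exists code, (fun b z => normal lt rep z /\ fst z < b /\ A b (code z)).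
  split; auto. split; [eauto|]. intros Z g a HZ a0.
  destruct (upper_bound2 HK a a0) as (a1 & Ha & Ha0).
  assert (Hg : exists h : K -> K, forall d, g d <= h d /\ g1 d <= h d).
  { exists (fun d => proj1_sig (constructive_indefinite_description _ (upper_bound2 HK (g d) (g1 d)))).
    intros d. destruct constructive_indefinite_description; auto. }
  destruct Hg as [h Hh].
  destruct (HA (fun c => exists z, Z z /\ code z = c) _ (club_closed HK h a1)) as [b [[Hb1 Hb2] Hb3]].
  assert (Hcode : forall z, normal lt rep z -> fst z < b -> code z < b).
  { intros z Hz Hzb. apply (lt_tr HK (b := g1 (fst z))); auto.
    apply (le_lt_tr HK (b := h (fst z))); auto. apply Hh. }
  exists b. split; [split; [split|]|].
  - exact (le_lt_tr HK Ha Hb1).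
  - intros c Hc. apply (le_lt_tr HK (b := h c)); auto. apply Hh.
  - intros z. split.
    + intros (H1 & H2 & H3). apply Hb3 in H3; auto. destruct H3 as (z' & H4 & H5).
      apply Hinj in H5; auto. subst z'. auto.
    + intros (H1 & H2). split; auto. split; auto. apply Hb3; eauto.
  - exact (le_lt_tr HK Ha0 Hb1).
Qed.

End Coding.

(* The elements of a well-ordering of [J] with at most [K] many predecessors have order
   type the successor cardinal of [K]. *)
Lemma successor_cardinal (J K : Type) : ~ injects J K ->
  exists (I : Type) (ltI : I -> I -> Prop) (iota : I -> J),
    strict_wellorder ltI /\ (forall i, injects {i' | ltI i' i} K) /\ ~ injects I K /\
    forall i i', iota i = iota i' -> i = i'.
Proof.
  intros HJ. destruct (well_ordering J) as [r Hr]. destruct Hr as (r1 & r2 & r3 & r4).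
  set (P x := injects {y | r y x} K).
  exists {x | P x}, (fun u v => r (proj1_sig u) (proj1_sig v)), (@proj1_sig _ _).
  split; [split; [|split; [|split]]|split; [|split]].
  - intros [x Hx]; simpl; auto.
  - intros u v w; apply r2.
  - intros u v. destruct (r3 (proj1_sig u) (proj1_sig v)) as [|[H|]]; auto.
    right; left. apply sig_eq, H.
  - apply (wf_inverse_image _ _ r (@proj1_sig _ P)), r4.
  - intros [x Hx]; simpl. refine (injects_trans _ Hx).
    exists (fun w : {u : {x | P x} | r (proj1_sig u) x} =>
      exist (fun y => r y x) (proj1_sig (proj1_sig w)) (proj2_sig w)).
    intros u v E. apply sig_eq, sig_eq. exact (f_equal (@proj1_sig _ _) E).
  - intros HI. destruct (classic (forall x, P x)) as [Hall|N].
    + apply HJ. refine (injects_trans _ HI).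
      exists (fun x => exist P x (Hall x)). intros x y E. exact (f_equal (@proj1_sig _ _) E).
    + apply not_all_ex_not in N.
      destruct (wf_least (fun x => ~ P x) r4 N) as (x & Hx & Hmin). apply Hx.
      refine (injects_trans _ HI).
      exists (fun u : {y | r y x} => exist P (proj1_sig u) (NNPP _ (Hmin _ (proj2_sig u)))).
      intros u v E. apply sig_eq. exact (f_equal (@proj1_sig _ _) E).
  - intros u v E. apply sig_eq, E.
Qed.

(** * The trees obtained from a Kurepa tree *)

Theorem theoremA (K : Type) (lt : K -> K -> Prop) :
  regular_uncountable_cardinal lt ->
  proxy_principle lt ->
  (exists (X : Type) (R : X -> X -> Prop), kurepa lt R) ->
  exists (T : Type) (R : T -> T -> Prop),
    aronszajn lt R /\
    exists (I : Type) (ltI : I -> I -> Prop) (S : I -> T -> Prop),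
      (* |I| = kappa^+ *)
      strict_wellorder ltI /\ (forall i, injects {j : I | ltI j i} K) /\
      ~ injects I K /\
      (* the subtrees S i are pairwise distinct *)
      (forall i j, (forall x, S i x <-> S j x) -> i = j) /\
      (forall i, subtree R (S i) /\ souslin lt (sub_rel R (S i))) /\
      (forall l : list I, l <> nil ->
         souslin lt (@prod_rel K lt T R I S (fun i => In i l))).
Proof.
  intros HK (Hdiamond & C & HC1 & HC2 & HC3) (X & R & HX & Hmany).
  set (J := branch lt R).
  assert (HJ : ~ injects J K).
  { intros [f Hf]. apply Hmany. exists f. intros u v E x. apply Hf in E. rewrite E. reflexivity. }
  assert (HJ0 : inhabited J).
  { apply NNPP. intros N. apply HJ. destruct (inhabited_K HK) as [k].
    exists (fun _ => k). intros j. destruct N. constructor; exact j. }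
  set (rep := @repr K lt X R : K -> J -> J).
  assert (Hsmall : forall a, small K {j : J | rep a j = j}) by exact (@repr_small K lt HK X R HX).
  destruct (@guess_exists K lt HK J rep Hsmall Hdiamond) as (code & Guess & H1 & H2 & H3).
  (* Having more than kappa branches, [J] contains a family indexed by the successor of kappa; its
     members index the subtrees. *)
  destruct (successor_cardinal HJ) as (I & ltI & iota & W1 & W2 & W3 & W4).
  assert (C_lt : forall a b, C a b -> lt b a) by (intros a; apply HC1).
  assert (C_closed : forall a b, lt b a -> is_sup lt (fun x => C a x /\ lt x b) b ->
    (exists z, lt z b) -> C a b) by (intros a; apply HC1).
  assert (C_sup : forall a, exists s, is_sup lt (fun b => lt b a) s /\ is_sup lt (C a) s)
    by (intros a; apply HC1).
  assert (rep_le : forall a b (j : J), le lt a b -> rep a (rep b j) = rep a j)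
    by exact (@repr_le K lt HK X R).
  assert (rep_lim : forall a (j j' : J), (forall b, lt b a -> exists c, lt b c /\ lt c a) ->
    (forall b, lt b a -> rep b j = rep b j') -> rep a j = rep a j') by exact (@repr_lim K lt X R).
  assert (rep_sep : forall j j' : J, (forall a, rep a j = rep a j') -> j = j')
    by exact (@repr_sep K lt HK X R HX).
  exists (node lt rep), (nodeR HK C Guess (rep := rep)). split.
  { eapply node_aronszajn; eauto. exact (@repr_complete K lt HK X R HX). }
  exists I, ltI, (fun i => along (iota i)).
  split; auto. split; auto. split; auto. split; [|split].
  - intros i j E. apply W4. eapply along_inj; eauto.
  - intros i. split; [eapply along_subtree; eauto|]. eapply along_souslin; eauto.
  - intros l Hl. eapply prod_souslin; eauto.
Qed.
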